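(* Let $n\in\mathbb N=\{1,2,\dots\}$. Up to similarity, the number $N_{\mathrm{ssd}}(n)$ of planar, slim, semimodular lattice diagrams with $n$ elements is $$N_{\mathrm{ssd}}(n)=\sum_{h=0}^{n-1}p(h,n-h-1),$$ where $p(h,k)$ denotes the number of permutations of $\{1,\dots,h\}$ having exactly $k$ inversions.
   Context: All lattices are finite. A lattice $L$ is slim if its set of nonzero join-irreducible elements contains no three-element antichain, and semimodular if $x\preceq y$ implies $x\vee z\preceq y\vee z$ for all $x,y,z\in L$ ($\preceq$ means ''covered by or equal''). Slim lattices are planar, i.e. they have planar (Hasse) diagrams. A diagram is called slim, semimodular, etc. if the lattice it represents has that property; the number of elements of a diagram is the number of elements of the lattice it determines. For planar lattice diagrams $D_1,D_2$, a bijection $\varphi\colon D_1\to D_2$ is a similarity map if it is a lattice isomorphism and, for all $x,y,z\in D_1$ with $x\prec y$ and $x\prec z$, $y$ is to the left of $z$ if and only if $\varphi(y)$ is to the left of $\varphi(z)$. $D_1$ and $D_2$ are similar if there is a similarity map $D_1\to D_2$. ''Up to similarity'' means similar diagrams are counted only once. The number of inversions of a permutation $\sigma$ is the number of pairs $a<b$ with $\sigma(a)>\sigma(b)$; for $h=0$ there is exactly one (empty) permutation, with $0$ inversions. *)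

(* Defs.v *)
From HB Require Import structures.
From mathcomp Require Import all_boot all_order all_algebra all_fingroup.
From mathcomp Require Import boolp classical_sets functions cardinality.
From mathcomp Require Import set_interval reals.

Set Implicit Arguments.
Unset Strict Implicit.
Unset Printing Implicit Defensive.

Import Order.TTheory GRing.Theory Num.Theory.

Local Open Scope order_scope.

Definition covers d (L : finPOrderType d) (x y : L) : bool :=
  (x < y) && [forall z : L, ~~ (x < z < y)].

Definition join_irreducibles d (L : finTBLatticeType d) : {set L} :=
  [set x : L | (x != \bot) &&
    [forall y : L, forall z : L, (x == y `|` z) ==> ((x == y) || (x == z))]].

Definition antichain d (L : finPOrderType d) (A : {set L}) : Prop :=
  {in A &, forall x y : L, x != y -> x >< y}.

Definition slim d (L : finTBLatticeType d) : Prop :=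
  forall A : {set L}, A \subset join_irreducibles L -> antichain A -> #|A| <> 3.

Definition covers_or_eq d (L : finPOrderType d) (x y : L) : bool :=
  (x == y) || covers x y.

Definition semimodular d (L : finTBLatticeType d) : Prop :=
  forall x y z : L, covers_or_eq x y -> covers_or_eq (x `|` z) (y `|` z).

Local Close Scope order_scope.

Definition inversions (h : nat) (s : 'S_h) : nat :=
  #|[set ij : 'I_h * 'I_h | (ij.1 < ij.2)%N && (s ij.2 < s ij.1)%N]|.

Definition num_perm_inversions (h k : nat) : nat :=
  #|[set s : 'S_h | inversions s == k]|.

Local Open Scope ring_scope.
Local Open Scope classical_set_scope.

Definition segment (R : realType) (p q : R * R) : set (R * R) :=
  [set ((1 - t) * p.1 + t * q.1, (1 - t) * p.2 + t * q.2) | t in `[0, 1]].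

(* Edges are straight segments; two different edges may meet only at (the image
   of) a common endpoint. Together with the injectivity of [pos], this also
   forbids an edge from passing through the image of a third element. *)
Record planar_diagram (R : realType) := PlanarDiagram {
  diagram_disp : Order.disp_t;
  lattice_of :> finTBLatticeType diagram_disp;
  pos : lattice_of -> R * R;
  pos_inj : injective pos;
  pos_upward : forall x y : lattice_of, (x < y)%O -> (pos x).2 < (pos y).2;
  pos_planar : forall a b c e : lattice_of,
    covers a b -> covers c e -> (a, b) <> (c, e) ->
    segment (pos a) (pos b) `&` segment (pos c) (pos e)
      `<=` pos @` ([set a; b] `&` [set c; e])
}.

(* For upper covers y and z of x, y is to the left of z when the edge [x, y]
   leaves x to the left of the edge [x, z]. Edges go strictly upwards, so the
   horizontal displacement per unit of height is well defined and orders the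
   edges starting at x from left to right. *)
Definition left_of (R : realType) (D : planar_diagram R) (x y z : D) : Prop :=
  ((pos y).1 - (pos x).1) / ((pos y).2 - (pos x).2)
    < ((pos z).1 - (pos x).1) / ((pos z).2 - (pos x).2).

Definition lattice_isomorphism d1 d2 (L1 : latticeType d1) (L2 : latticeType d2)
    (f : L1 -> L2) : Prop :=
  [/\ bijective f,
      {morph f : x y / (x `&` y)%O >-> (x `&` y)%O} &
      {morph f : x y / (x `|` y)%O >-> (x `|` y)%O}].

Definition similarity_map (R : realType) (D1 D2 : planar_diagram R)
    (f : D1 -> D2) : Prop :=
  lattice_isomorphism f /\
  forall x y z : D1, covers x y -> covers x z ->
    (left_of x y z <-> left_of (f x) (f y) (f z)).

Definition similar_diagrams (R : realType) (D1 D2 : planar_diagram R) : Prop :=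
  exists f : D1 -> D2, similarity_map f.

Lemma similar_diagrams_refl (R : realType) (D : planar_diagram R) :
  similar_diagrams D D.
Proof. by exists id; split=> //; split=> //; exists id. Qed.

Lemma similar_diagrams_sym (R : realType) (D1 D2 : planar_diagram R) :
  similar_diagrams D1 D2 -> similar_diagrams D2 D1.
Proof.
case=> f [[[g fK gK] fI fU] fl].
have gI : {morph g : x y / (x `&` y)%O >-> (x `&` y)%O}.
  by move=> x y; apply: (can_inj fK); rewrite fI !gK.
have gU : {morph g : x y / (x `|` y)%O >-> (x `|` y)%O}.
  by move=> x y; apply: (can_inj fK); rewrite fU !gK.
have gle : {mono g : x y / (x <= y)%O}.
  by move=> x y; rewrite !leEmeet -gI (can_eq gK).
have glt := leW_mono gle.
have gc x y : covers x y -> covers (g x) (g y).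
  move=> /andP[xy /forallP c]; rewrite /covers glt xy; apply/forallP => z.
  by have := c (f z); rewrite -!glt fK.
exists g; split; first by split=> //; exists f.
move=> x y z /gc xy /gc xz.
by have := fl _ _ _ xy xz; rewrite !gK => -[? ?]; split.
Qed.

Lemma similar_diagrams_trans (R : realType) (D1 D2 D3 : planar_diagram R) :
  similar_diagrams D1 D2 -> similar_diagrams D2 D3 -> similar_diagrams D1 D3.
Proof.
case=> f [[fb fI fU] fl] [g [[gb gI gU] gl]].
have fle : {mono f : x y / (x <= y)%O}.
  by move=> x y; rewrite !leEmeet -fI (bij_eq fb).
have flt := leW_mono fle.
have fc x y : covers x y -> covers (f x) (f y).
  case: fb => f' fK f'K /andP[xy /forallP c].
  rewrite /covers flt xy; apply/forallP => z.
  by have := c (f' z); rewrite -!flt f'K.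
exists (g \o f); split.
  by split; [exact: bij_comp | move=> x y; rewrite /= fI gI
                             | move=> x y; rewrite /= fU gU].
move=> x y z xy xz; have [a b] := fl _ _ _ xy xz.
by have [c e] := gl _ _ _ (fc _ _ xy) (fc _ _ xz); split=> [/a/c|/e/b].
Qed.

Definition slim_semimodular_diagram (R : realType) (n : nat)
    (D : planar_diagram R) : Prop :=
  [/\ slim D, semimodular D & #|D| = n].

(* There are exactly N elements satisfying P up to the equivalence relation E:
   some N pairwise inequivalent elements represent all of them. This is phrased
   with representatives because a [set] of equivalence classes of diagrams would
   not fit in the universe of [set]. *)
Definition number_up_to (T : Type) (E : T -> T -> Prop) (P : T -> Prop)
    (N : nat) : Prop :=
  exists D : 'I_N -> T,
    [/\ forall i, P (D i),
        forall i j, E (D i) (D j) -> i = j &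
        forall X, P X -> exists i, E X (D i)].

(* Main.v *)
(** The elements of a slim semimodular diagram [D] of length [h] are located by
    the two boundary chains [r] and [l], which start at the bottom and always
    follow the rightmost, resp. leftmost, upper cover. Planarity says that an
    edge leaving the left corner of a 4-cell upwards does not enter the cell;
    since by slimness an element has at most two upper covers, it follows that
    [x `|` r i.+1] is the rightmost cover of [x] whenever [r i] but not [r i.+1]
    is below [x], and dually for [l]. Hence every element is [r i `|` l j], the
    pair [(i, j)] taken maximal embeds [D] in a product of two chains, and the
    projectivities between the prime intervals of [r] and [l] form a permutation
    [s] which determines the image.

    Conversely [s] is realized by the sets [{c | i <= c, j <= s c}] under reverse
    inclusion: the nonempty ones correspond to the pairs [a <= b] with
    [s b <= s a], that is, to the [h] points and the inversions of [s], and the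
    order embedding in a product of two chains, turned by 45 degrees, is a
    planar diagram. *)

Require Import Defs.
From HB Require Import structures.
From mathcomp Require Import all_boot all_order all_algebra all_fingroup.
From mathcomp Require Import reals.
From mathcomp Require Import ring lra zify.

Set Implicit Arguments.
Unset Strict Implicit.
Unset Printing Implicit Defensive.

Import Order.TTheory GRing.Theory Num.Theory.

(** * Upper covers in slim semimodular lattices *)

Section Covers.
Local Open Scope order_scope.
Variables (d : Order.disp_t) (L : finPOrderType d).
Implicit Types x y z : L.

(** The cardinality of this set is strictly monotone in [x] and serves as the rank in all
    well-founded arguments. *)
Let down x : {set L} := [set t | t <= x].

Let down_lt x y : x < y -> (#|down x| < #|down y|)%N.
Proof.
move=> xy; apply: proper_card; apply/properP; split.
  by apply/subsetP => t; rewrite !inE => /le_trans; apply; exact: ltW.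
by exists y; rewrite inE ?lexx // lt_geF.
Qed.

Lemma covers_lt x y : covers x y -> x < y.
Proof. by case/andP. Qed.

Lemma covers_between x y z : covers x y -> x < z -> z <= y -> z = y.
Proof.
case/andP=> _ /forallP/(_ z) + xz; rewrite xz /= le_eqVlt => /negPf->.
by rewrite orbF => /eqP.
Qed.

Lemma exists_minimal (P : pred L) x :
  P x -> exists2 z, P z & forall t, P t -> ~~ (t < z).
Proof.
move=> Px; case: (arg_minnP (fun z => #|down z|) Px) => z Pz zmin.
exists z => // t /zmin; apply: contraTN => /down_lt.
by rewrite ltnNge.
Qed.

Lemma exists_cover_above x y : x < y -> exists2 z, covers x z & z <= y.
Proof.
move=> xy; have := @exists_minimal (fun z => x < z <= y) y.
rewrite xy lexx => /(_ isT)[z /andP[xz zy] zmin]; exists z => //.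
rewrite /covers xz; apply/forallP => t; apply/negP => /andP[xt tz].
by have := zmin t; rewrite xt (le_trans (ltW tz) zy) tz => /(_ isT).
Qed.

Lemma exists_cover_below x y : x < y -> exists2 z, covers z y & x <= z.
Proof.
move=> xy; have Px : x <= x < y by rewrite lexx.
case: (@arg_maxnP _ x (fun z => x <= z < y) (fun z => #|down z|) Px).
move=> z /andP[xz zy] zmax; exists z => //.
rewrite /covers zy; apply/forallP => t; apply/negP => /andP[zt ty].
have := zmax t; rewrite (le_trans xz (ltW zt)) ty => /(_ isT) tz.
by have := leq_ltn_trans tz (down_lt zt); rewrite ltnn.
Qed.

Lemma covers_neq_le x y z : covers x y -> covers x z -> y != z -> ~~ (y <= z).
Proof.
move=> xy xz; apply: contraNN => yz; apply/eqP.
exact: covers_between xz (covers_lt xy) yz.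
Qed.

Lemma covers_neq_ge x y z : covers y x -> covers z x -> y != z -> ~~ (y <= z).
Proof.
move=> yx zx yz; apply/negP => le_yz; have [_ /forallP/(_ z)] := andP yx.
by rewrite lt_neqAle yz le_yz covers_lt.
Qed.

Lemma covers_interval x y z : covers x y -> x <= z -> z <= y -> z = x \/ z = y.
Proof.
move=> xy; rewrite le_eqVlt => /predU1P[->|xz]; first by left.
by right; exact: covers_between xy xz _.
Qed.

Lemma lt_ind_finPOrder (P : L -> Prop) :
  (forall x, (forall y, y < x -> P y) -> P x) -> forall x, P x.
Proof.
move=> IH x; have [n] := ubnP #|down x|; elim: n => // n IHn in x *.
by rewrite ltnS => xn; apply: IH => y /down_lt yx; exact/IHn/(leq_trans yx).
Qed.

End Covers.

Section SlimSemimodular.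
Local Open Scope order_scope.
Variables (d : Order.disp_t) (L : finTBLatticeType d).
Implicit Types x y z : L.

Lemma covers_meet x y z : covers x y -> covers x z -> y != z -> y `&` z = x.
Proof.
move=> xy xz yz; apply/eqP/negPn/negP => yzx.
have xlt : x < y `&` z.
  by rewrite lt_def yzx lexI (ltW (covers_lt xy)) (ltW (covers_lt xz)).
move: (covers_neq_le xy xz yz); apply/negP/negPn.
by rewrite -(covers_between xy xlt (leIl _ _)) leIr.
Qed.

(** Take [p] minimal among the elements below [y] and not below [x]. All elements strictly below [p]
    are then below [x], hence so is any join of two of them. *)
Lemma join_irreducible_below_cover x y : covers x y ->
  exists p, [/\ p \in join_irreducibles L, p <= y & ~~ (p <= x)].
Proof.
move=> /covers_lt xy.
have [p /andP[py px] pmin] : exists2 p, (p <= y) && ~~ (p <= x) &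
    forall t, (t <= y) && ~~ (t <= x) -> ~~ (t < p).
  by apply: (@exists_minimal _ _ _ y); rewrite lexx lt_geF.
exists p; split=> //; rewrite inE; apply/andP; split.
  by apply: contraNN px => /eqP->; exact: le0x.
apply/'forall_forallP => s t; apply/implyP => /eqP pst.
apply: contraNT px; rewrite negb_or => /andP[ps pt].
have below u : u <= p -> p != u -> u <= x.
  move=> up pu; apply: contraT => ux.
  have := pmin u; rewrite (le_trans up py) ux => /(_ isT).
  by rewrite lt_def pu up.
by rewrite [p in p <= x]pst leUx !below // pst ?leUl ?leUr.
Qed.

(** Two distinct covers of [x] meet in [x]. So join-irreducibles below distinct covers, but not
    below [x], are incomparable, and three covers would yield a three-element antichain. *)
Lemma slim_covers x a b c : slim L ->
  covers x a -> covers x b -> covers x c -> [|| a == b, a == c | b == c].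
Proof.
move=> sl xa xb xc; apply: contraT; rewrite !negb_or => /and3P[ab ac bc].
have [p [pJ pa px]] := join_irreducible_below_cover xa.
have [q [qJ qb qx]] := join_irreducible_below_cover xb.
have [r [rJ rc rx]] := join_irreducible_below_cover xc.
have incomp u v y z : covers x y -> covers x z -> y != z -> u <= y -> v <= z ->
    ~~ (u <= x) -> ~~ (u <= v).
  move=> xy xz yz uy vz; apply: contraNN => uv.
  by rewrite -(covers_meet xy xz yz) lexI uy (le_trans uv vz).
have pq : ~~ (p <= q) by apply: (incomp _ _ _ _ xa xb).
have pr : ~~ (p <= r) by apply: (incomp _ _ _ _ xa xc).
have qr : ~~ (q <= r) by apply: (incomp _ _ _ _ xb xc).
have qp : ~~ (q <= p) by apply: (incomp _ _ _ _ xb xa); rewrite // eq_sym.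
have rp : ~~ (r <= p) by apply: (incomp _ _ _ _ xc xa); rewrite // eq_sym.
have rq : ~~ (r <= q) by apply: (incomp _ _ _ _ xc xb); rewrite // eq_sym.
have neq (u v : L) : ~~ (u <= v) -> u != v.
  by apply: contraNN => /eqP->.
exfalso; apply: (sl [set p; q; r]).
- by apply/subsetP => u; rewrite !inE => /orP[/orP[]|] /eqP->; move: pJ qJ rJ;
    rewrite !inE.
- move=> u v; rewrite !inE /Order.comparable negb_or.
  by do 2!case/orP => [/orP[]|] /eqP->; rewrite ?eqxx // ?(pq, pr, qr, qp, rp, rq).
- by rewrite setUC cardsU1 cards2 !inE negb_or ![r == _]eq_sym !neq.
Qed.

Lemma semimodular_join_covers x y z : semimodular L ->
  covers x y -> x <= z -> ~~ (y <= z) -> covers z (y `|` z).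
Proof.
move=> sm xy xz yz; have := sm x y z; rewrite /covers_or_eq xy orbT => /(_ isT).
rewrite (join_idPr xz) => /orP[/eqP E|//].
by rewrite E leUl in yz.
Qed.

End SlimSemimodular.

(** * Boundary chains *)

Section Rightmost.
Local Open Scope order_scope.
Variables (d : Order.disp_t) (L : finTBLatticeType d) (lr : L -> rel L).
Implicit Types (x y z : L) (i j k : nat).

(** [lr x y z] is read as [y] being to the left of [z] above [x]; the reversed relation yields the
    left boundary. The default [x] makes the chain stationary at the top. *)
Definition rightmost x : L :=
  odflt x [pick y | covers x y &&
                    [forall z, covers x z && (z != y) ==> lr x z y]].

Definition right_chain k : L := iter k rightmost \bot.

Lemma rightmost_le x : x <= rightmost x.
Proof. by rewrite /rightmost; case: pickP => //= y /andP[/covers_lt/ltW]. Qed.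

Lemma right_chain_le : {homo right_chain : i j / (i <= j)%N >-> i <= j}.
Proof. by apply: homo_leq => //=; [exact: le_trans | move=> i; exact: rightmost_le]. Qed.

Hypothesis lr_total : forall x y z, covers x y -> covers x z -> y != z ->
  lr x y z = ~~ lr x z y.

Lemma rightmost_unique x y : covers x y ->
  (forall z, covers x z -> z != y -> lr x z y) -> rightmost x = y.
Proof.
move=> xy ymax; rewrite /rightmost; case: pickP => [t|/(_ y)] /=; last first.
  by rewrite xy /= => /negP[]; apply/forallP => z; apply/implyP => /andP[/ymax].
case/andP=> xt /forallP/(_ y); rewrite xy /=.
have [//|ty] /= := eqVneq t y.
by rewrite (lr_total xy xt) ?(ymax t) // eq_sym.
Qed.

Hypothesis two_covers : forall x a b c,
  covers x a -> covers x b -> covers x c -> [|| a == b, a == c | b == c].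

Lemma rightmostP x : x != \top -> covers x (rightmost x) /\
  forall z, covers x z -> z != rightmost x -> lr x z (rightmost x).
Proof.
rewrite -ltx1 => /exists_cover_above[y xy _].
suff [t xt tmax] : exists2 t, covers x t & forall z, covers x z -> z != t -> lr x z t.
  by rewrite (rightmost_unique xt tmax).
have [/forallP ymax|] := boolP [forall z, covers x z && (z != y) ==> lr x z y].
  by exists y => // z xz zy; apply: (implyP (ymax z)); rewrite xz.
rewrite negb_forall => /existsP[z]; rewrite negb_imply => /andP[/andP[xz zy] nzy].
exists z => // t xt tz; have /or3P[/eqP ty|/eqP ty|/eqP yz] := two_covers xt xy xz.
- by rewrite ty lr_total // eq_sym.
- by rewrite ty eqxx in tz.
- by rewrite yz eqxx in zy.
Qed.

Lemma rightmost_lt x : x != \top -> x < rightmost x.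
Proof. by case/rightmostP => /covers_lt. Qed.

Lemma right_chain_top :
  exists2 h, right_chain h = \top & forall k, (k < h)%N -> right_chain k != \top.
Proof.
have ex : exists k, right_chain k == \top.
  apply: boolp.contrapT => /boolp.forallNP nt.
  (* If the top were never reached, the down-sets of the chain would grow at every step, beyond the
     size of [L]. *)
  have H k : (k < #|[set t : L | (t <= right_chain k)%O]|)%N.
    elim: k => [|k IHk]; first by rewrite (cardD1 \bot) inE lexx.
    apply: (leq_ltn_trans IHk); apply: proper_card; apply/properP; split.
      by apply/subsetP => t; rewrite !inE => /le_trans; apply; exact: rightmost_le.
    exists (right_chain k.+1); rewrite inE ?lexx // lt_geF //.
    by apply: rightmost_lt; apply/negP; exact: nt.
  by have := leq_trans (H #|L|) (max_card _); rewrite ltnn.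
case: (ex_minnP ex) => h /eqP ht hmin; exists h => // k; rewrite ltnNge.
by apply: contraNN; exact: hmin.
Qed.

Hypothesis semimod : semimodular L.
(** The geometric input, supplied for planar diagrams by [left_ofb_cell] and its mirror image
    [right_ofb_cell]. *)
Hypothesis lr_cell : forall x y z u, covers x y -> covers x z -> lr x y z ->
  covers y u -> u != y `|` z -> lr y u (y `|` z).

(* Walking up from [right_chain i] to [x], each step leaves the 4-cell spanned
   by the step and the rightmost cover through its upper right edge. *)
Lemma join_right_chain i x :
  right_chain i <= x -> ~~ (right_chain i.+1 <= x) ->
  x `|` right_chain i.+1 = rightmost x.
Proof.
elim/lt_ind_finPOrder: x => x IHx ix ix1.
have [xi|xi] := eqVneq (right_chain i) x.
  by rewrite -xi; apply/join_idPr; exact: rightmost_le.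
have /exists_cover_below[y yx iy] : right_chain i < x by rewrite lt_neqAle xi.
have iy1 : ~~ (right_chain i.+1 <= y).
  by apply: contraNN ix1 => /le_trans; apply; exact: ltW (covers_lt yx).
have := IHx y (covers_lt yx) iy iy1 => yE.
have yt : y != \top by rewrite -ltx1 (lt_le_trans (covers_lt yx)) ?lex1.
have [yr ymax] := rightmostP yt.
have xr : x != rightmost y.
  by apply: contraNneq ix1 => ->; rewrite -yE leUr.
have := ymax x yx xr => lyx.
have xjE : x `|` right_chain i.+1 = x `|` rightmost y.
  by rewrite -yE joinA (join_idPl (ltW (covers_lt yx))).
have xj : covers x (x `|` rightmost y).
  rewrite joinC; apply: (semimodular_join_covers semimod yr).
    exact: ltW (covers_lt yx).
  by apply: covers_neq_le yr yx _; rewrite eq_sym.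
rewrite xjE; apply/esym/rightmost_unique => // z xz.
exact: lr_cell yx yr lyx xz.
Qed.

End Rightmost.

(** * Coordinates with respect to two complete chains, and the permutation relating them *)

Section ChainIndex.
Local Open Scope order_scope.
Variables (d : Order.disp_t) (L : finTBLatticeType d).
Implicit Types (x y z : L) (i j k : nat).

Definition chain_index (r : nat -> L) h x : nat := (\max_(k < h.+1 | (r k <= x)%O) k)%N.

Definition complete_chain (r : nat -> L) (h : nat) : Prop :=
  [/\ r 0%N = \bot, r h = \top, {homo r : i j / (i <= j)%N >-> i <= j} &
      forall k, (k < h)%N -> r k < r k.+1].

Variables (r : nat -> L) (h : nat).
Hypothesis rP : complete_chain r h.

Lemma chain_index_le x : (chain_index r h x <= h)%N.
Proof. by apply/bigmax_leqP => k _; rewrite -ltnS. Qed.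

(** The maximum is attained, since [r 0] is the bottom, and [r] is monotone. The index is thus the
    upper adjoint of the chain. *)
Lemma chain_indexP k x : (k <= h)%N -> (r k <= x) = (k <= chain_index r h x)%N.
Proof.
case: rP => r0 _ rle _ kh; apply/idP/idP => [kx|].
  by apply: (@bigop.bigmax_sup _ (Ordinal (kh : (k < h.+1)%N))).

move=> kr; apply: le_trans (rle _ _ kr) _; rewrite /chain_index.
have := @eq_bigmax_cond _ (fun k : 'I_h.+1 => r k <= x) (fun k : 'I_h.+1 => k : nat).
case; last by move=> k' + ->.
by apply/card_gt0P; exists ord0; rewrite unfold_in r0 le0x.
Qed.

Lemma chain_index_mono x y : x <= y -> (chain_index r h x <= chain_index r h y)%N.
Proof.
move=> xy; rewrite -chain_indexP ?chain_index_le //; apply: le_trans xy.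
by rewrite chain_indexP ?chain_index_le.
Qed.

Lemma chain_index_top : chain_index r h \top = h.
Proof.
by apply/eqP; rewrite eqn_leq chain_index_le -chain_indexP ?lex1.
Qed.

Lemma chain_index_lt x : x != \top -> (chain_index r h x < h)%N.
Proof.
move=> xt; rewrite ltnNge -chain_indexP //; case: rP => _ -> _ _.
by rewrite le1x.
Qed.

Lemma chain_indexE k x : (k < h)%N ->
  (chain_index r h x == k) = (r k <= x) && ~~ (r k.+1 <= x).
Proof. by move=> kh; rewrite !chain_indexP ?(ltnW kh) // -ltnNge ltnS eqn_leq andbC. Qed.

Lemma chain_index_spec x : x != \top ->
  r (chain_index r h x) <= x /\ ~~ (r (chain_index r h x).+1 <= x).
Proof.
move=> xt; have xh := chain_index_lt xt.
by rewrite !chain_indexP ?chain_index_le // ltnn leqnn.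
Qed.

End ChainIndex.

Section TwoChains.
Local Open Scope order_scope.
Variables (d : Order.disp_t) (L : finTBLatticeType d).
Variables (r l : nat -> L) (hr hl : nat).
Hypotheses (rP : complete_chain r hr) (lP : complete_chain l hl).
Hypothesis r_cover : forall i x, r i <= x -> ~~ (r i.+1 <= x) -> covers x (x `|` r i.+1).
Hypothesis l_cover : forall j x, l j <= x -> ~~ (l j.+1 <= x) -> covers x (x `|` l j.+1).

(* The prime intervals [r i, r i.+1] and [l j, l j.+1] are projective to each
   other through the 4-cell (or edge) above [r i `|` l j]. *)
Definition corner i j : bool :=
  ~~ (r i.+1 <= r i `|` l j) && (r i.+1 <= r i `|` l j.+1).

(** Corners are symmetric in the two chains: with [x = r i]|[l j], the covers [x]|[r i.+1] and
    [x]|[l j.+1] of [x] are comparable, hence equal. *)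
Lemma corner_swap i j : corner i j ->
  ~~ (l j.+1 <= l j `|` r i) && (l j.+1 <= l j `|` r i.+1).
Proof.
case/andP=> nri rij; have [[_ _ rle _] [_ _ lle _]] := (rP, lP).
rewrite ![l j `|` _]joinC; set x := r i `|` l j in nri *.
have nlj : ~~ (l j.+1 <= x).
  by apply: contraNN nri => ljx; apply: le_trans rij _; rewrite leUx leUl.
rewrite nlj /=; have cr := r_cover (leUl _ _ : r i <= x) nri.
have cl := l_cover (leUr _ _ : l j <= x) nlj.
have rl : x `|` r i.+1 <= x `|` l j.+1.
  by rewrite leUx leUl (le_trans rij) // leU2 // leUl.
have := covers_between cl (covers_lt cr) rl => E.
apply: le_trans (leUr _ x) _; rewrite -E leUx leUl andbT.
by rewrite leU2 // rle.
Qed.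

Lemma corner_exists i : (i < hr)%N -> exists2 j, (j < hl)%N & corner i j.
Proof.
move=> ih; have [[_ _ _ rlt] [l0 lt _ _]] := (rP, lP).
have ex : exists j, r i.+1 <= r i `|` l j by exists hl; rewrite lt joinx1 lex1.
(* The least such index is not 0, because [l 0] is the bottom and [r i < r i.+1]; its predecessor
   gives the corner. *)
case: (ex_minnP ex) => -[|j] rj jmin.
  by rewrite l0 joinx0 lt_geF ?rlt in rj.
exists j; last by rewrite /corner rj andbT; apply/negP => /jmin; rewrite ltnn.
by apply: jmin; rewrite lt joinx1 lex1.
Qed.

Lemma corner_inj_r i j j' : corner i j -> corner i j' -> j = j'.
Proof.
have [_ _ lle _] := lP.
have H k k' : corner i k -> corner i k' -> (k' <= k)%N.
  move=> /andP[_ rk] /andP[nrk' _]; rewrite leqNgt; apply: contraNN nrk' => kk'.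
  by apply: le_trans rk _; rewrite leU2 // lle.
by move=> c c'; apply/eqP; rewrite eqn_leq !H.
Qed.

End TwoChains.

Section TwoChainsPerm.
Local Open Scope order_scope.
Variables (d : Order.disp_t) (L : finTBLatticeType d).
Variables (r l : nat -> L) (hr hl : nat).
Hypotheses (rP : complete_chain r hr) (lP : complete_chain l hl).
Hypothesis r_cover : forall i x, r i <= x -> ~~ (r i.+1 <= x) -> covers x (x `|` r i.+1).
Hypothesis l_cover : forall j x, l j <= x -> ~~ (l j.+1 <= x) -> covers x (x `|` l j.+1).
Hypothesis branch : forall x y i j, covers x y ->
  r i <= x -> ~~ (r i.+1 <= x) -> l j <= x -> ~~ (l j.+1 <= x) ->
  y = x `|` r i.+1 \/ y = x `|` l j.+1.

Let ri := chain_index r hr.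
Let li := chain_index l hl.

Lemma corner_inj_l i i' j : corner r l i j -> corner r l i' j -> i = i'.
Proof.
move=> /(corner_swap rP lP r_cover l_cover) c /(corner_swap rP lP r_cover l_cover) c'.
exact: (corner_inj_r rP c c').
Qed.

(** Corners define injections both ways between the prime intervals of the two chains. So the
    lengths agree and the first injection is a permutation. *)
Lemma corner_perm : exists (s : 'S_hr), hl = hr /\ forall i : 'I_hr, corner r l i (s i).
Proof.
have /fin_all_exists[f fP] (i : 'I_hr) : exists j : 'I_hl, corner r l i j.
  by have [j jl c] := corner_exists rP lP (ltn_ord i); exists (Ordinal jl).
have /fin_all_exists[g gP] (j : 'I_hl) : exists i : 'I_hr, corner l r j i.
  by have [i ir c] := corner_exists lP rP (ltn_ord j); exists (Ordinal ir).
have finj : injective f.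
  by move=> i i' E; apply/val_inj; apply: (corner_inj_l (fP i)); rewrite E; exact: fP.
have ginj : injective g.
  move=> j j' E; apply/val_inj.
  have := corner_swap lP rP l_cover r_cover (gP j).
  have := corner_swap lP rP l_cover r_cover (gP j').
  by rewrite E => c' c; exact: (corner_inj_r lP c c').
have := leq_card f finj; have := leq_card g ginj; rewrite !card_ord => lr rl.
have hlr : hl = hr by apply/eqP; rewrite eqn_leq lr.
move: f fP finj {g gP ginj lr rl}; rewrite hlr => f fP finj.
by exists (perm finj); split=> // i; rewrite permE.
Qed.

(** Induction along a lower cover [y] of [x]: by [branch], [x] is the join of [y] with the next
    element of one of the chains, which raises that coordinate. *)
Lemma chain_coordsE x : x = r (ri x) `|` l (li x).
Proof.
have [[_ _ rle _] [_ _ lle _]] := (rP, lP).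
apply/eqP; rewrite eq_le leUx (chain_indexP rP) ?(chain_indexP lP) ?chain_index_le //.
rewrite !leqnn !andbT.
elim/lt_ind_finPOrder: x => x IHx.
have [x0|] := eqVneq x \bot; first by rewrite {1}x0 le0x.
rewrite -lt0x => /exists_cover_below[y yx _].
have yt : y != \top by rewrite -ltx1 (lt_le_trans (covers_lt yx)) ?lex1.
have [riy nriy] := chain_index_spec rP yt.
have [liy nliy] := chain_index_spec lP yt.
have yle : y <= r (ri x) `|` l (li x).
  apply: le_trans (IHx y (covers_lt yx)) _; have yx' := ltW (covers_lt yx).
  by rewrite leU2 ?rle ?lle ?chain_index_mono.
have [xE|xE] := branch yx riy nriy liy nliy; rewrite {1}xE leUx yle /=.
  apply: le_trans (leUl _ _); apply: rle.
  by rewrite -(chain_indexP rP) ?chain_index_lt // xE leUr.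
apply: le_trans (leUr _ _); apply: lle.
by rewrite -(chain_indexP lP) ?chain_index_lt // xE leUr.
Qed.

Lemma chain_coords_le x y : (x <= y) = (ri x <= ri y)%N && (li x <= li y)%N.
Proof.
apply/idP/andP => [xy|[rxy lxy]]; first by rewrite !chain_index_mono.
have [[_ _ rle _] [_ _ lle _]] := (rP, lP).
by rewrite (chain_coordsE x) (chain_coordsE y) leU2 ?rle ?lle.
Qed.

Section Corners.
Variable s : 'S_hr.
Hypotheses (hlr : hl = hr) (sP : forall i : 'I_hr, corner r l i (s i)).

(** [r a.+1] is not below [r a]|[l (s a)], and a fortiori not below [r a]|[l (s b)]; dually for [l]
    at the corner of [b]. *)
Lemma corner_coords (a b : 'I_hr) : (a <= b)%N -> (s b <= s a)%N ->
  ri (r a `|` l (s b)) = a /\ li (r a `|` l (s b)) = s b.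
Proof.
have [[_ _ rle _] [_ _ lle _]] := (rP, lP) => ab sba.
have /andP[nra _] := sP a.
have /andP[nlb _] := corner_swap rP lP r_cover l_cover (sP b).
split; apply/eqP.
  rewrite (chain_indexE rP) // leUl; apply: contraNN nra => /le_trans; apply.
  by rewrite leU2 // lle.
rewrite (chain_indexE lP) ?hlr // leUr; apply: contraNN nlb => /le_trans; apply.
by rewrite joinC leU2 // rle.
Qed.

(** Take for [b] the preimage of the left coordinate under [s]. If [b < a], the corner of [b] would
    put the next element of [l] below [x]; if [s a < s b], the corner of [a] would do so for [r]. *)
Lemma coords_corner x : x != \top ->
  exists a b : 'I_hr, [/\ ri x = a, li x = s b, (a <= b)%N & (s b <= s a)%N].
Proof.
have [[_ _ rle _] [_ _ lle _]] := (rP, lP) => xt.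
have rh := chain_index_lt rP xt; have := chain_index_lt lP xt; rewrite {2}hlr => lh.
have [rx nrx] := chain_index_spec rP xt; have [lx nlx] := chain_index_spec lP xt.
pose a := Ordinal rh; pose b := (s^-1)%g (Ordinal lh).
have sb : s b = Ordinal lh by rewrite permKV.
exists a, b; rewrite sb; split=> //; rewrite leqNgt.
  apply: contraNN nlx => ba.
  have /andP[_ lb] := corner_swap rP lP r_cover l_cover (sP b).
  rewrite sb /= in lb; apply: le_trans lb _; rewrite leUx lx.
  by apply: le_trans rx; apply: rle.
apply: contraNN nrx => /= sab.
have /andP[_ ra] := sP a.
apply: le_trans ra _; rewrite leUx rx.
by apply: le_trans lx; apply: lle.
Qed.

End Corners.

End TwoChainsPerm.

Lemma leq_bigminP (I : finType) (m h : nat) (P : pred I) (F : I -> nat) :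
  reflect (m <= h /\ forall i, P i -> m <= F i) (m <= \big[Order.min/h]_(i | P i) F i).
Proof. by rewrite -leEnat; exact: bigmin_geP. Qed.

Lemma bigmin_leq (I : finType) (h : nat) (P : pred I) (F : I -> nat) i :
  P i -> \big[Order.min/h]_(i | P i) F i <= F i.
Proof. by rewrite -leEnat; exact: bigmin_le_cond. Qed.

(** * The lattice of quadrants of a permutation *)

Section Quadrants.
Variables (h : nat) (s : 'S_h).
Implicit Types (A B : {set 'I_h}) (i j : nat).

Definition quadrant i j : {set 'I_h} := [set c : 'I_h | (i <= c) && (j <= s c)].

(* On [set0] both coordinates take the default value [h], one more than the
   largest possible coordinate of a point. *)
Definition coord1 A : nat := \big[Order.min/h]_(c in A) (c : nat).
Definition coord2 A : nat := \big[Order.min/h]_(c in A) (s c : nat).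

Lemma coord1_le A : coord1 A <= h.
Proof. by rewrite -leEnat; exact: bigmin_le_id. Qed.

Lemma coord2_le A : coord2 A <= h.
Proof. by rewrite -leEnat; exact: bigmin_le_id. Qed.

(** A Galois connection between sets and pairs of coordinates. The bounds on [i] and [j] reflect the
    default [h] of the minima. *)
Lemma sub_quadrant A i j : i <= h -> j <= h ->
  (A \subset quadrant i j) = (i <= coord1 A) && (j <= coord2 A).
Proof.
move=> ih jh; apply/subsetP/andP => [sub|[iA jA] c cA].
  by split; apply/leq_bigminP; split=> // c /sub; rewrite inE => /andP[].
rewrite inE (leq_trans iA) ?(leq_trans jA) //; exact: bigmin_leq.
Qed.

Definition is_quadrant A : bool :=
  [exists ij : 'I_h.+1 * 'I_h.+1, A == quadrant ij.1 ij.2].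

(** An index beyond [h] selects no point, just as [h] does, so indices may be capped at [h]. *)
Lemma quadrant_is_quadrant i j : is_quadrant (quadrant i j).
Proof.
have lt_min k : minn k h < h.+1 by rewrite ltnS geq_minr.
apply/existsP; exists (Ordinal (lt_min i), Ordinal (lt_min j)).
by apply/eqP/setP => c; rewrite !inE /= !geq_min ![h <= _]leqNgt !ltn_ord !orbF.
Qed.

Lemma quadrant_coords A : is_quadrant A -> quadrant (coord1 A) (coord2 A) = A.
Proof.
case/existsP=> -[i j] /eqP /= AE; apply/eqP; rewrite eqEsubset.
rewrite sub_quadrant ?coord1_le ?coord2_le // !leqnn /= andbT {3}AE.
have : A \subset quadrant i j by rewrite AE.
rewrite sub_quadrant ?leq_ord // => /andP[iA jA].
apply/subsetP => c; rewrite !inE => /andP[ci cj].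
by rewrite (leq_trans iA) // (leq_trans jA).
Qed.

Lemma quadrantI i j i' j' :
  quadrant i j :&: quadrant i' j' = quadrant (maxn i i') (maxn j j').
Proof. by apply/setP => c; rewrite !inE !geq_max; do 4!case: (_ <= _). Qed.

Lemma is_quadrantI A B : is_quadrant A -> is_quadrant B -> is_quadrant (A :&: B).
Proof.
move=> /existsP[[i j] /eqP->] /existsP[[i' j'] /eqP->].
by rewrite quadrantI quadrant_is_quadrant.
Qed.

(** The hypotheses say that the points [a] and [b] both lie in the quadrant; they attain the two
    minima. *)
Lemma coord_quadrant (a b : 'I_h) : a <= b -> s b <= s a ->
  coord1 (quadrant a (s b)) = a /\ coord2 (quadrant a (s b)) = s b.
Proof.
move=> ab sba; have := subxx (quadrant a (s b)).
rewrite (sub_quadrant _ (ltnW (ltn_ord a)) (ltnW (ltn_ord (s b)))) => /andP[aQ bQ].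
by split; apply/eqP; rewrite eqn_leq ?aQ ?bQ andbT; apply: bigmin_leq;
  rewrite inE ?ab ?sba leqnn.
Qed.

Lemma is_quadrant_corner A : is_quadrant A -> A != set0 -> exists a b : 'I_h,
  [/\ a \in A, b \in A, coord1 A = a & coord2 A = s b].
Proof.
move=> qA /set0Pn[c cA].
have [a aA a1] : exists2 a, a \in A & coord1 A = a.
  case: (@arg_minnP _ c (mem A) val cA) => a aA amin; exists a => //.
  apply/eqP; rewrite eqn_leq bigmin_leq //.
  by apply/leq_bigminP; split; [exact: ltnW | exact: amin].
have [b bA b1] : exists2 b, b \in A & coord2 A = s b.
  case: (@arg_minnP _ c (mem A) (val \o s) cA) => b bA bmin; exists b => //.
  apply/eqP; rewrite eqn_leq bigmin_leq //.
  by apply/leq_bigminP; split; [exact: ltnW | exact: bmin].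
by exists a, b.
Qed.

End Quadrants.

Definition quadrant_lattice h (s : 'S_h) : Type := {A : {set 'I_h} | is_quadrant s A}.

Section QuadrantLattice.
Variables (h : nat) (s : 'S_h).
Local Notation L := (quadrant_lattice s).
Implicit Types x y z : L.

HB.instance Definition _ := Finite.on L.

(** Reverse inclusion lets both coordinates increase with the order and puts the empty quadrant at
    the top. *)
Definition quadrant_le x y : bool := val y \subset val x.

Lemma quadrant_leE x y :
  quadrant_le x y =
  (coord1 (val x) <= coord1 (val y)) && (coord2 s (val x) <= coord2 s (val y)).
Proof.
rewrite /quadrant_le -[in LHS](quadrant_coords (valP x)).
by rewrite sub_quadrant ?coord1_le ?coord2_le.
Qed.

Lemma quadrant_le_refl : reflexive quadrant_le.
Proof. by move=> x; exact: subxx. Qed.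

Lemma quadrant_le_anti : antisymmetric quadrant_le.
Proof.
move=> x y /andP[yx xy]; apply/val_inj/eqP.
by rewrite eqEsubset; apply/andP; split.
Qed.

Lemma quadrant_le_trans : transitive quadrant_le.
Proof. by move=> y x z yx zy; exact: subset_trans zy yx. Qed.

Fact quadrant_display : Order.disp_t. Proof. exact: Order.Disp tt tt. Qed.

HB.instance Definition _ := Order.Le_isPOrder.Build quadrant_display L
  quadrant_le_refl quadrant_le_anti quadrant_le_trans.

Definition quadrant_join x y : L := Sub (val x :&: val y) (is_quadrantI (valP x) (valP y)).

(** A union of quadrants need not be a quadrant; the meet is the least quadrant containing it. *)
Definition quadrant_meet x y : L :=
  Sub _ (quadrant_is_quadrant s (minn (coord1 (val x)) (coord1 (val y)))
                                (minn (coord2 s (val x)) (coord2 s (val y)))).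

Lemma quadrant_meetP x y z :
  (x <= quadrant_meet y z)%O = (x <= y)%O && (x <= z)%O.
Proof.
rewrite /Order.le /=.
apply/idP/andP => [xm|[xy xz]].
  split; apply: quadrant_le_trans xm _; rewrite /quadrant_le sub_quadrant;
    by rewrite ?geq_min ?coord1_le ?coord2_le ?leqnn ?orbT.
rewrite /quadrant_le -(quadrant_coords (valP x)); move: xy xz; rewrite !quadrant_leE.
move=> /andP[xy1 xy2] /andP[xz1 xz2]; apply/subsetP => c; rewrite !inE.
by case/andP=> c1 c2; rewrite (leq_trans _ c1) ?(leq_trans _ c2) // leq_min ?xy1 ?xy2.
Qed.

Lemma quadrant_joinP x y z :
  (quadrant_join x y <= z)%O = (x <= z)%O && (y <= z)%O.
Proof. exact: subsetI. Qed.

HB.instance Definition _ := Order.POrder_MeetJoin_isLattice.Build quadrant_display L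
  quadrant_meetP quadrant_joinP.

Definition quadrant_bot : L := Sub _ (quadrant_is_quadrant s 0 0).
Definition quadrant_top : L := Sub _ (quadrant_is_quadrant s h h).

Lemma quadrant_le0x x : (quadrant_bot <= x)%O.
Proof. by rewrite [(_ <= _)%O]sub_quadrant. Qed.

Lemma quadrant_lex1 x : (x <= quadrant_top)%O.
Proof.
apply/subsetP => c; rewrite inE => /andP[].
by rewrite leqNgt ltn_ord.
Qed.

HB.instance Definition _ := Order.hasBottom.Build quadrant_display L quadrant_le0x.
HB.instance Definition _ := Order.hasTop.Build quadrant_display L quadrant_lex1.

End QuadrantLattice.

(** * Coverings, semimodularity, slimness and size of the quadrant lattice *)

Section QuadrantLatticeTheory.
Variables (h : nat) (s : 'S_h).
Local Notation L := (quadrant_lattice s).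
Implicit Types x y z : L.

Lemma quadrant_subE x y : (x <= y)%O = (val y \subset val x).
Proof. by []. Qed.

Lemma quadrant_coords_le x y : (x <= y)%O =
  (coord1 (val x) <= coord1 (val y)) && (coord2 s (val x) <= coord2 s (val y)).
Proof. exact: quadrant_leE. Qed.

Lemma quadrant_ltE x y : (x < y)%O = (val y \proper val x).
Proof. by rewrite lt_neqAle quadrant_subE properEneq eq_sym. Qed.

(** Some coordinate grows strictly from [x] to [y]. Raising that coordinate of [x] by one removes a
    single point, as a permutation has one point in each row and column. *)
Lemma quadrant_remove x y : (x < y)%O ->
  exists c, [/\ c \in val x, c \notin val y & is_quadrant s (val x :\ c)].
Proof.
rewrite lt_neqAle => /andP[xy]; rewrite quadrant_coords_le => /andP[le1 le2].
have x0 : val x != set0.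
  apply: contraNneq xy => x0; apply/eqP/val_inj/eqP.
  have : val y \subset val x by rewrite -quadrant_subE quadrant_coords_le le1.
  by rewrite x0 subset0 eq_sym.
have [a [b [ax bx a1 b2]]] := is_quadrant_corner (valP x) x0.
have yE := quadrant_coords (valP y); have xE := quadrant_coords (valP x).
have [lt1|ge1] := ltnP (coord1 (val x)) (coord1 (val y)).
  exists a; split=> //.
    by rewrite -yE inE -a1 leqNgt lt1.
  have -> : val x :\ a = quadrant s a.+1 (coord2 s (val x)).
    apply/setP => c; rewrite -[in LHS]xE !inE a1 ltn_neqAle andbA.
    by rewrite -(inj_eq val_inj) eq_sym.
  exact: quadrant_is_quadrant.
have [lt2|ge2] := ltnP (coord2 s (val x)) (coord2 s (val y)).
  exists b; split=> //.
    by rewrite -yE inE -b2 [_ <= coord2 _ _]leqNgt lt2 andbF.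
  have -> : val x :\ b = quadrant s (coord1 (val x)) (s b).+1.
    apply/setP => c; rewrite -[in LHS]xE !inE b2 [s b < _]ltn_neqAle andbCA.
    by rewrite -(inj_eq (@perm_inj _ s)) -(inj_eq val_inj) eq_sym.
  exact: quadrant_is_quadrant.
case/negP: xy; apply/eqP/val_inj; rewrite -xE -yE.
by congr quadrant; apply/eqP; rewrite eqn_leq ?le1 ?le2.
Qed.

(** The quadrant [val x :\ c] of the previous lemma lies between [x] and [y]. With
    [card_quadrant_covers] below, coverings are exactly the removals of one point. *)
Lemma quadrant_covers_remove x y : covers x y ->
  exists2 c, c \in val x & val y = val x :\ c.
Proof.
move=> xy; have [c [cx cy qc]] := quadrant_remove (covers_lt xy).
exists c => //; pose z : L := Sub _ qc.
suff -> : y = z by [].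
apply/esym/(covers_between xy); first by rewrite quadrant_ltE /= properD1.
rewrite quadrant_subE /= subsetD1 cy andbT -quadrant_subE.
exact: ltW (covers_lt xy).
Qed.

Lemma card_quadrant_covers x y : (x < y)%O -> #|val x| <= #|val y|.+1 -> covers x y.
Proof.
move=> xy card; rewrite /covers xy /=; apply/forallP => z; apply/negP => /andP[].
rewrite !quadrant_ltE => /proper_card zx /proper_card yz.
by have := leq_trans (leq_ltn_trans yz zx) card; rewrite ltnn.
Qed.

(** Joins are intersections, and two nested sets differing by one point differ by at most one point
    after intersection with a third. *)
Lemma quadrant_semimodular : semimodular L.
Proof.
move=> x y z; rewrite /covers_or_eq.
have [->|_ /= xy] := eqVneq x y; first by rewrite eqxx.
have [//|xzyz] /= := eqVneq; apply: card_quadrant_covers.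
  by rewrite lt_neqAle xzyz leU2 // ltW // covers_lt.
have [c cx yE] := quadrant_covers_remove xy.
have card_le (A B : {set 'I_h}) : #|A :&: B| <= #|(A :\ c) :&: B|.+1.
  by rewrite setIDAC (cardsD1 c) -add1n leq_add2r leq_b1.
by apply: leq_trans (card_le _ _) _; rewrite -yE.
Qed.

(** These two chains turn out to be the boundary chains of the diagram: see [right_chain_quadrant]
    and [left_chain_quadrant]. *)
Definition right_edge i : L := Sub _ (quadrant_is_quadrant s i 0).
Definition left_edge j : L := Sub _ (quadrant_is_quadrant s 0 j).

Lemma right_edge_le i x : i <= h -> (right_edge i <= x)%O = (i <= coord1 (val x)).
Proof. by move=> ih; rewrite quadrant_subE sub_quadrant // andbT. Qed.

Lemma left_edge_le j x : j <= h -> (left_edge j <= x)%O = (j <= coord2 s (val x)).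
Proof. by move=> jh; rewrite quadrant_subE sub_quadrant. Qed.

Lemma edge_joinE x :
  x = (right_edge (coord1 (val x)) `|` left_edge (coord2 s (val x)))%O.
Proof.
apply/val_inj; rewrite -[LHS](quadrant_coords (valP x)).
by apply/setP => c; rewrite !inE andbT.
Qed.

Lemma right_edge_total i j : (right_edge i >=< right_edge j)%O.
Proof.
wlog ij : i j / i <= j => [H|].
  by case/orP: (leq_total i j) => /H //; rewrite comparable_sym.
apply: le_comparable; rewrite quadrant_subE; apply/subsetP => c; rewrite !inE.
by rewrite !andbT; exact: leq_trans.
Qed.

Lemma left_edge_total i j : (left_edge i >=< left_edge j)%O.
Proof.
wlog ij : i j / i <= j => [H|].
  by case/orP: (leq_total i j) => /H //; rewrite comparable_sym.
apply: le_comparable; rewrite quadrant_subE; apply/subsetP => c; rewrite !inE /=.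
exact: leq_trans.
Qed.

(** By [edge_joinE], join-irreducibles lie on one of the two edge chains, and an antichain has at
    most one element on each. *)
Lemma quadrant_slim : slim L.
Proof.
move=> A /subsetP AJ Aanti.
pose D := [set x : L | x == right_edge (coord1 (val x))].
have D1 : #|A :&: D| <= 1.
  apply/card_le1_eqP => x y; rewrite !inE => /andP[xA /eqP xE] /andP[yA /eqP yE].
  apply/eqP/negPn/negP => /Aanti-/(_ yA xA); rewrite xE yE.
  by rewrite right_edge_total.
have D2 : #|A :\: D| <= 1.
  have left_edgeE x : x \in A :\: D -> x = left_edge (coord2 s (val x)).
    rewrite inE => /andP[xD /AJ]; rewrite inE => /andP[_].
    move=> /forallP/(_ (right_edge (coord1 (val x))))/forallP/(_ (left_edge (coord2 s (val x)))); rewrite -edge_joinE eqxx /=.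
    by rewrite inE in xD; rewrite (negPf xD) => /eqP.
  apply/card_le1_eqP => x y xAD yAD; have xA := subsetP (subsetDl A D) x xAD.
  have yA := subsetP (subsetDl A D) y yAD.
  apply/eqP/negPn/negP => /Aanti-/(_ yA xA); rewrite (left_edgeE x xAD) (left_edgeE y yAD).
  by rewrite left_edge_total.
by rewrite -(cardsID D) => E; have := leq_add D1 D2; rewrite E.
Qed.

Lemma right_edge_covers i : i < h -> covers (right_edge i) (right_edge i.+1).
Proof.
move=> ih; have E : quadrant s i.+1 0 = quadrant s i 0 :\ Ordinal ih.
  apply/setP => c; rewrite !inE !andbT ltn_neqAle eq_sym.
  by rewrite -(inj_eq val_inj).
have ii : Ordinal ih \in quadrant s i 0 by rewrite inE leqnn.
apply: card_quadrant_covers; rewrite ?quadrant_ltE /= E ?properD1 //.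
by rewrite [#|quadrant s i 0|](cardsD1 (Ordinal ih)) ii.
Qed.

Lemma left_edge_covers j : j < h -> covers (left_edge j) (left_edge j.+1).
Proof.
move=> jh; pose b := (s^-1)%g (Ordinal jh).
have sb : s b = Ordinal jh by rewrite permKV.
have E : quadrant s 0 j.+1 = quadrant s 0 j :\ b.
  apply/setP => c; rewrite !inE /= ltn_neqAle eq_sym.
  by rewrite -(inj_eq (@perm_inj _ s) c) -(inj_eq val_inj) sb.
have jj : b \in quadrant s 0 j by rewrite inE sb /=.
apply: card_quadrant_covers; rewrite ?quadrant_ltE /= E ?properD1 //.
by rewrite [#|quadrant s 0 j|](cardsD1 b) jj.
Qed.

Lemma card_quadrant_lattice : #|{: L}| = (h + inversions s).+1.
Proof.
pose P := [set p : 'I_h * 'I_h | (p.1 <= p.2) && (s p.2 <= s p.1)].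
pose Q (p : 'I_h * 'I_h) := quadrant s p.1 (s p.2).
have QE : [set A | is_quadrant s A] = set0 |: [set Q p | p in P].
  apply/setP => A; rewrite !inE; have [->|A0] /= := eqVneq A set0.
    have <- : quadrant s h h = set0; last exact: quadrant_is_quadrant.
    by apply/setP => c; rewrite !inE leqNgt ltn_ord.
  apply/idP/imsetP => [qA|[p _ ->]]; last exact: quadrant_is_quadrant.
  have [a [b [aA bA a1 b1]]] := is_quadrant_corner qA A0.
  exists (a, b); last by rewrite /Q /= -a1 -b1 quadrant_coords.
  move: aA bA; rewrite -(quadrant_coords qA) !inE a1 b1.
  by move=> /andP[_ ->] /andP[->].
have Qinj : {in P &, injective Q}.
  move=> [a b] [a' b']; rewrite !inE /Q /= => /andP[ab sba] /andP[ab' sba'] E.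
  have [a1 b1] := coord_quadrant ab sba; have [a1' b1'] := coord_quadrant ab' sba'.
  congr pair; first by apply: val_inj; rewrite /= -a1 -a1' E.
  by apply: (@perm_inj _ s); apply: val_inj; rewrite /= -b1 -b1' E.
rewrite card_sig -cardsE QE cardsU1 card_in_imset //.
have -> : set0 \notin [set Q p | p in P].
  apply/imsetP => -[[a b]]; rewrite inE => /andP[ab sba] /= /setP/(_ a).
  by rewrite !inE leqnn sba.
(* The successor counts the empty quadrant. Among the pairs, the diagonal contributes [h] and the
   rest are the inversions. *)
rewrite add1n; congr _.+1; rewrite -(cardsID [set p | p.1 == p.2]); congr addn.
  have diag_inj : injective (fun a : 'I_h => (a, a)) by move=> a b [].
  rewrite -[RHS]card_ord -cardsT -(card_imset _ diag_inj).
  apply: eq_card => -[a b]; rewrite !inE /=.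
  apply/andP/imsetP => [[_ /eqP->]|[c _ [-> ->]]].
    by exists b.
  by rewrite !leqnn.
apply: eq_card => -[a b]; rewrite !inE /=.
have [->|ab] := eqVneq a b; first by rewrite ltnn.
by rewrite !ltn_neqAle !val_eqE (inj_eq (@perm_inj _ s)) [b == a]eq_sym ab.
Qed.

End QuadrantLatticeTheory.

(** * Planar diagrams of lattices of order dimension two *)

Section OrderDimensionTwo.
Variables (d : Order.disp_t) (L : finTBLatticeType d) (e1 e2 : L -> nat).
Hypothesis e_le : forall x y, (x <= y)%O = (e1 x <= e1 y)%N && (e2 x <= e2 y)%N.
Implicit Types x y z : L.

Lemma coords_incomparable y z : ~~ (y <= z)%O -> ~~ (z <= y)%O ->
  (e1 y < e1 z)%N /\ (e2 z < e2 y)%N \/ (e1 z < e1 y)%N /\ (e2 y < e2 z)%N.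
Proof. rewrite !e_le; lia. Qed.

Lemma coords_covers x y z : covers x y -> covers x z -> y != z ->
  (e1 y < e1 z)%N /\ (e2 z < e2 y)%N \/ (e1 z < e1 y)%N /\ (e2 y < e2 z)%N.
Proof.
move=> xy xz yz; apply: coords_incomparable; first exact: covers_neq_le xy xz yz.
by apply: covers_neq_le xz xy _; rewrite eq_sym.
Qed.

Variable R : realType.
Local Open Scope ring_scope.

Definition rotated_pos x : R * R := ((e1 x)%:R - (e2 x)%:R, (e1 x)%:R + (e2 x)%:R).

Lemma e_inj x y : e1 x = e1 y -> e2 x = e2 y -> x = y.
Proof. by move=> E1 E2; apply/eqP; rewrite eq_le !e_le E1 E2 !leqnn. Qed.

Lemma rotated_pos_inj : injective rotated_pos.
Proof.
move=> x y [E1 E2]; apply: e_inj; apply/eqP; rewrite -(eqr_nat R); apply/eqP; lra.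
Qed.

Lemma rotated_pos_upward x y : (x < y)%O -> (rotated_pos x).2 < (rotated_pos y).2.
Proof.
rewrite lt_neqAle e_le => /andP[xy /andP[le1 le2]] /=.
rewrite -!natrD ltr_nat ltn_neqAle leq_add // andbT.
by apply: contraNneq xy => E; apply/eqP/e_inj; lia.
Qed.

Lemma crossing_rays (t u p q p' q' : R) : 0 <= t -> 0 <= u -> 0 <= p -> 0 <= q' ->
  p < p' -> q' < q -> t * p = u * p' -> t * q = u * q' -> t = 0 /\ u = 0.
Proof.
move=> t0 u0 p0 q0 pp qq E1 E2.
have tE : t = 0.
  apply/eqP; rewrite eq_le t0 andbT leNgt; apply/negP => tp.
  (* The second equation with [q' < q] gives [t <= u]; then [t * p < t * p' <= u * p'] contradicts
     the first. *)
  have tu : t <= u; first by nra.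
  have := ltr_pM2l tp p p'; nra.
by split=> //; move: E1; rewrite tE mul0r => /esym/eqP; rewrite mulf_eq0; lra.
Qed.

Lemma convex_bounds (t p q : R) : 0 <= t <= 1 -> p <= q ->
  p <= (1 - t) * p + t * q <= q.
Proof. by move=> t01 pq; apply/andP; split; nra. Qed.

Lemma crossing_segments_from (t u a1 a2 b1 b2 c1 c2 : R) : 0 <= t -> 0 <= u ->
  a1 <= b1 -> a2 <= c2 -> b1 < c1 -> c2 < b2 ->
  (1 - t) * a1 + t * b1 = (1 - u) * a1 + u * c1 ->
  (1 - t) * a2 + t * b2 = (1 - u) * a2 + u * c2 -> t = 0 /\ u = 0.
Proof.
move=> t0 u0 ab ac bc cb E1 E2.
by apply: (@crossing_rays t u (b1 - a1) (b2 - a2) (c1 - a1) (c2 - a2)) => //; lra.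
Qed.

Lemma crossing_segments_to (t u a1 a2 b1 b2 c1 c2 : R) : t <= 1 -> u <= 1 ->
  b1 <= a1 -> c2 <= a2 -> c1 < b1 -> b2 < c2 ->
  (1 - t) * b1 + t * a1 = (1 - u) * c1 + u * a1 ->
  (1 - t) * b2 + t * a2 = (1 - u) * c2 + u * a2 -> t = 1 /\ u = 1.
Proof.
move=> t0 u0 ab ac bc cb E1 E2.
have [] := @crossing_rays (1 - t) (1 - u) (a1 - b1) (a2 - b2) (a1 - c1) (a2 - c2); lra.
Qed.

(* If [a `|` c] is below both [b] and [e] then, [a, b] and [c, e] being
   coverings, it is an end of both. *)
Lemma rotated_pos_crossing a b c e (t u : R) :
  covers a b -> covers c e -> (a, b) <> (c, e) -> 0 <= t <= 1 -> 0 <= u <= 1 ->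
  (1 - t) * (rotated_pos a).1 + t * (rotated_pos b).1 =
    (1 - u) * (rotated_pos c).1 + u * (rotated_pos e).1 ->
  (1 - t) * (rotated_pos a).2 + t * (rotated_pos b).2 =
    (1 - u) * (rotated_pos c).2 + u * (rotated_pos e).2 ->
  exists m, [/\ m = a \/ m = b, m = c \/ m = e,
    (1 - t) * (rotated_pos a).1 + t * (rotated_pos b).1 = (rotated_pos m).1 &
    (1 - t) * (rotated_pos a).2 + t * (rotated_pos b).2 = (rotated_pos m).2].
Proof.
move=> ab ce nabce t01 u01 /= E1 E2.
have eR x y : (x <= y)%O -> (e1 x)%:R <= (e1 y)%:R :> R /\ (e2 x)%:R <= (e2 y)%:R :> R.
  by rewrite e_le !ler_nat => /andP[].
have Re x y : (e1 x)%:R <= (e1 y)%:R :> R -> (e2 x)%:R <= (e2 y)%:R :> R -> (x <= y)%O.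
  by rewrite !ler_nat e_le => -> ->.
(* Half the sum and half the difference of the two equations undo the rotation. *)
have X : (1 - t) * (e1 a)%:R + t * (e1 b)%:R = (1 - u) * (e1 c)%:R + u * (e1 e)%:R :> R.
  lra.
have Y : (1 - t) * (e2 a)%:R + t * (e2 b)%:R = (1 - u) * (e2 c)%:R + u * (e2 e)%:R :> R.
  lra.
have [ab1 ab2] := eR _ _ (ltW (covers_lt ab)).
have [ce1 ce2] := eR _ _ (ltW (covers_lt ce)).
have /andP[aX Xb] := convex_bounds t01 ab1; have /andP[aY Yb] := convex_bounds t01 ab2.
have := convex_bounds u01 ce1; have := convex_bounds u01 ce2.
rewrite -X -Y => /andP[cY Ye] /andP[cX Xe].
(* In the product order, the common point is above [a] and [c] and below [b] and [e]. *)
have ae : (a <= e)%O by apply: Re; [exact: le_trans aX Xe | exact: le_trans aY Ye].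
have cb : (c <= b)%O by apply: Re; [exact: le_trans cX Xb | exact: le_trans cY Yb].
have amb : (a `|` c <= b)%O by rewrite leUx cb ltW ?covers_lt.
have cme : (a `|` c <= e)%O by rewrite leUx ae ltW ?covers_lt.
have [m1|m1] := covers_interval ab (leUl a c) amb;
  have [m2|m2] := covers_interval ce (leUr c a) cme; rewrite m1 in m2.
(* The four cases are a common lower end, the two ways of stacking the edges, and a common upper
   end. For stacked edges the bounds force the common point to be the shared element. *)
- subst c; have be : b != e by apply: contra_notN nabce => /eqP->.
  exists a; have [] : t = 0 /\ u = 0; last first.
    by move=> -> _; rewrite subr0 !mul1r !mul0r !addr0; split; [left|left| |].
  case/andP: t01 u01 => t0 _ /andP[u0 _].
  have [[lt1 lt2]|[lt1 lt2]] := coords_covers ab ce be.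
    by apply: (crossing_segments_from t0 u0 ab1 ce2 _ _ X Y); rewrite ltr_nat.
  by have [] := crossing_segments_from u0 t0 ce1 ab2 _ _ (esym X) (esym Y);
    rewrite ?ltr_nat.
- have E : e = a by rewrite m2.
  exists a; subst e; split; [by left|by right|lra|lra].
- have E : b = c by rewrite m2.
  exists b; subst c; split; [by right|by left|lra|lra].
- have E : e = b by rewrite m2.
  subst e; have ac : a != c by apply: contra_notN nabce => /eqP->.
  exists b; have [] : t = 1 /\ u = 1; last first.
    by move=> -> _; rewrite subrr !mul1r !mul0r !add0r; split; [right|right| |].
  case/andP: t01 u01 => _ t1 /andP[_ u1].
  have nac := covers_neq_ge ab ce ac.
  have nca : ~~ (c <= a)%O by apply: covers_neq_ge ce ab _; rewrite eq_sym.
  have [[lt1 lt2]|[lt1 lt2]] := coords_incomparable nac nca.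
    by have [] := crossing_segments_to u1 t1 ce1 ab2 _ _ (esym X) (esym Y);
      rewrite ?ltr_nat.
  by apply: (crossing_segments_to t1 u1 ab1 ce2 _ _ X Y); rewrite ltr_nat.
Qed.

Lemma rotated_pos_planar a b c e :
  covers a b -> covers c e -> (a, b) <> (c, e) ->
  classical_sets.subset
    (classical_sets.setI (segment (rotated_pos a) (rotated_pos b))
                         (segment (rotated_pos c) (rotated_pos e)))
    (classical_sets.image
      (classical_sets.setI
        (classical_sets.setU (classical_sets.set1 a) (classical_sets.set1 b))
        (classical_sets.setU (classical_sets.set1 c) (classical_sets.set1 e)))
      rotated_pos).
Proof.
move=> ab ce nabce _ [[t /= t01 <-] [u /= u01 [E1 E2]]].
rewrite !in_itv /= in t01 u01.
have [m [mab mce X Y]] := rotated_pos_crossing ab ce nabce t01 u01 (esym E1) (esym E2).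
by exists m; rewrite ?X ?Y.
Qed.

Definition rotated_diagram : planar_diagram R :=
  PlanarDiagram rotated_pos_inj rotated_pos_upward rotated_pos_planar.

(** Cross-multiplication reduces the claim to [u1 * v2 < v1 * u2]. *)
Lemma slope_lt (u1 u2 v1 v2 : R) : 0 <= u1 -> 0 <= v2 -> u1 < v1 -> v2 < u2 ->
  (u1 - u2) / (u1 + u2) < (v1 - v2) / (v1 + v2).
Proof.
move=> u1_ge0 v2_ge0 uv vu; rewrite ltr_pdivrMr; last lra.
rewrite mulrAC ltr_pdivlMr; last lra.
have : u1 * v2 <= v1 * v2 by apply: ler_wpM2r => //; exact: ltW.
have : v1 * v2 < v1 * u2 by rewrite ltr_pM2l //; lra.
nra.
Qed.

Lemma left_of_rotated x y z : covers x y -> covers x z ->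
  left_of (D := rotated_diagram) x y z <-> (e1 y < e1 z)%N.
Proof.
move=> xy xz; rewrite /left_of /=.
have slopeE w : ((e1 w)%:R - (e2 w)%:R - ((e1 x)%:R - (e2 x)%:R)) /
    ((e1 w)%:R + (e2 w)%:R - ((e1 x)%:R + (e2 x)%:R)) =
    (((e1 w)%:R - (e1 x)%:R) - ((e2 w)%:R - (e2 x)%:R)) /
    (((e1 w)%:R - (e1 x)%:R) + ((e2 w)%:R - (e2 x)%:R)) :> R.
  by congr (_ / _); ring.
have [->|yz] := eqVneq y z; first by rewrite ltxx ltnn.
have := covers_lt xy; have := covers_lt xz.
move=> /ltW; rewrite e_le => /andP[xz1 xz2] /ltW; rewrite e_le => /andP[xy1 xy2].
rewrite !slopeE; have [[lt1 lt2]|[lt1 lt2]] := coords_covers xy xz yz.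
  rewrite lt1; split=> // _.
  by apply: slope_lt; rewrite ?subr_ge0 ?ltrD2r ?ler_nat ?ltr_nat.
rewrite ltnNge (ltnW lt1) /=; split=> //; rewrite ltNge => /negP[].
by apply/ltW/slope_lt; rewrite ?subr_ge0 ?ltrD2r ?ler_nat ?ltr_nat.
Qed.

End OrderDimensionTwo.

(** * Planarity of 4-cells *)

Section UpwardPaths.
Local Open Scope ring_scope.
Variables (R : realType) (d : Order.disp_t) (L : finTBLatticeType d) (px py : L -> R).
Implicit Types (a b c e f x y z : L) (s : R).

Definition edge_slope a b : R := (px b - px a) / (py b - py a).

(** The abscissa at height [s] on the line through the edge: since edges go upwards, height can
    serve as their parameter. *)
Definition edge_at a b s : R := px a + edge_slope a b * (s - py a).

Definition path_at a b c s : R := if s <= py b then edge_at a b s else edge_at b c s.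

Hypothesis py_lt : forall x y, covers x y -> py x < py y.
Hypothesis edge_disjoint : forall a b c e s, covers a b -> covers c e ->
  a \notin [:: c; e] -> b \notin [:: c; e] ->
  py a <= s <= py b -> py c <= s <= py e -> edge_at a b s <> edge_at c e s.
Hypothesis edge_slope_inj : forall x y z, covers x y -> covers x z ->
  edge_slope x y = edge_slope x z -> y = z.

Lemma edge_at_bot a b : edge_at a b (py a) = px a.
Proof. by rewrite /edge_at subrr mulr0 addr0. Qed.

Lemma edge_at_top a b : covers a b -> edge_at a b (py b) = px b.
Proof.
move=> /py_lt ab; rewrite /edge_at divfK ?subrK //; first by rewrite addrC subrK.
by rewrite subr_eq0 gt_eqF.
Qed.

Lemma path_at_bot a b c : covers a b -> path_at a b c (py a) = px a.
Proof. by move=> /py_lt/ltW ab; rewrite /path_at ab edge_at_bot. Qed.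

Lemma path_at_top a b c : covers b c -> path_at a b c (py c) = px c.
Proof. by move=> bc; rewrite /path_at leNgt (py_lt bc) edge_at_top. Qed.

Lemma affine_sign_change (p k q m s1 s2 : R) : s1 <= s2 ->
  p + k * s1 < q + m * s1 -> q + m * s2 <= p + k * s2 ->
  exists2 s, s1 <= s <= s2 & p + k * s = q + m * s.
Proof.
move=> s12 lt1 le2; have km : 0 < k - m by nra.
exists ((q - p) / (k - m)).
  by rewrite ler_pdivlMr // ler_pdivrMr //; apply/andP; split; lra.
have : (k - m) * ((q - p) / (k - m)) = q - p.
  by rewrite mulrCA divff ?mulr1 ?gt_eqF.
lra.
Qed.

(** Two edges exchanging sides would meet at an intermediate height, by [affine_sign_change]. *)
Lemma edge_side a b c e s1 s2 : covers a b -> covers c e ->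
  a \notin [:: c; e] -> b \notin [:: c; e] -> s1 <= s2 ->
  py a <= s1 -> s2 <= py b -> py c <= s1 -> s2 <= py e ->
  edge_at a b s1 < edge_at c e s1 -> edge_at a b s2 < edge_at c e s2.
Proof.
move=> ab ce nace nbce s12 as1 bs2 cs1 es2 lt1; rewrite ltNge; apply/negP => le2.
have affine x y s : edge_at x y s = (px x - edge_slope x y * py x) + edge_slope x y * s.
  by rewrite /edge_at; ring.
rewrite !affine in lt1 le2; have [s /andP[s1s ss2]] := affine_sign_change s12 lt1 le2.
rewrite -!affine; apply: edge_disjoint => //; apply/andP; split.
- exact: le_trans as1 s1s.
- exact: le_trans ss2 bs2.
- exact: le_trans cs1 s1s.
- exact: le_trans ss2 es2.
Qed.

(** [edge_side] is applied below and above the middle vertex [e], at whose height both edges of the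
    path have the same abscissa. The next lemma splits the other path likewise. *)
Lemma edge_path_side a b c e f s1 s2 : covers a b -> covers c e -> covers e f ->
  a \notin [:: c; e; f] -> b \notin [:: c; e; f] -> s1 <= s2 ->
  py a <= s1 -> s2 <= py b -> py c <= s1 -> s2 <= py f ->
  edge_at a b s1 < path_at c e f s1 -> edge_at a b s2 < path_at c e f s2.
Proof.
rewrite !inE !negb_or => ab ce ef /and3P[ac ae af] /and3P[bc be bf] s12 as1 bs2 cs1 fs2.
have ace : a \notin [:: c; e] by rewrite !inE negb_or ac.
have aef : a \notin [:: e; f] by rewrite !inE negb_or ae.
have bce : b \notin [:: c; e] by rewrite !inE negb_or bc.
have bef : b \notin [:: e; f] by rewrite !inE negb_or be.
rewrite /path_at; case: (leP s1 (py e)) => s1e; case: (leP s2 (py e)) => s2e.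
- exact: edge_side.
- move=> lt1; have : edge_at a b (py e) < edge_at c e (py e).
    by apply: edge_side lt1 => //; apply: le_trans bs2; exact: ltW.
  rewrite edge_at_top // -(edge_at_bot e f); apply: edge_side => //.
  + exact: ltW.
  + exact: le_trans as1 s1e.
- by have := lt_le_trans s1e (le_trans s12 s2e); rewrite ltxx.
- by apply: edge_side => //; exact: ltW.
Qed.

Lemma path_side a b c e f g s1 s2 :
  covers a b -> covers b c -> covers e f -> covers f g ->
  a \notin [:: e; f; g] -> b \notin [:: e; f; g] -> c \notin [:: e; f; g] ->
  s1 <= s2 -> py a <= s1 -> s2 <= py c -> py e <= s1 -> s2 <= py g ->
  path_at a b c s1 < path_at e f g s1 -> path_at a b c s2 < path_at e f g s2.
Proof.
move=> ab bc ef fg na nb nc s12 as1 cs2 es1 gs2.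
rewrite {1 3}/path_at; case: (leP s1 (py b)) => s1b; case: (leP s2 (py b)) => s2b.
- exact: edge_path_side.
- move=> lt1; have : edge_at a b (py b) < path_at e f g (py b).
    by apply: edge_path_side lt1 => //; apply: le_trans gs2; exact: ltW.
  rewrite edge_at_top // -(edge_at_bot b c); apply: edge_path_side => //.
  + exact: ltW.
  + exact: le_trans es1 s1b.
- by have := lt_le_trans s1b (le_trans s12 s2b); rewrite ltxx.
- by apply: edge_path_side => //; exact: ltW.
Qed.

(** The edges to [y] and [z] share [x], so their slopes decide up to the height of [z]; above it,
    [edge_side] compares [x, y] with [z, w]. *)
Lemma wedge_side x y z w : covers x y -> covers x z -> covers z w ->
  edge_slope x y < edge_slope x z -> y \notin [:: z; w] -> py y <= py w ->
  px y < path_at x z w (py y).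
Proof.
move=> xy xz zw lt_slope nyzw yw.
have lt_edge s : py x < s -> edge_at x y s < edge_at x z s.
  by move=> xs; rewrite ltrD2l ltr_pM2r // subr_gt0.
rewrite -(edge_at_top xy) /path_at; case: (leP (py y) (py z)) => yz.
  exact: lt_edge (py_lt xy).
have := lt_edge _ (py_lt xz); rewrite (edge_at_top xz) -(edge_at_bot z w).
apply: edge_side => //; try exact: ltW (py_lt _); try exact: ltW.
have xz_lt := covers_lt xz; have zw_lt := covers_lt zw.
by rewrite !inE negb_or (lt_eqF xz_lt) (lt_eqF (lt_trans xz_lt zw_lt)).
Qed.

Hypothesis semimod : semimodular L.

(* If the edge [y, u] entered the 4-cell [x, y, z, w], the path from [y] to
   [u `|` w] through [u] would have to cross the path from [x] to [w] through [z]. *)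
Lemma cell_side x y z u : covers x y -> covers x z -> edge_slope x y < edge_slope x z ->
  covers y u -> u != (y `|` z)%O -> edge_slope y u < edge_slope y (y `|` z)%O.
Proof.
move=> xy xz lt_slope yu; set w := (y `|` z)%O => uw.
have yz : y != z by apply: contraTneq lt_slope => ->; rewrite ltxx.
have zy : z != y by rewrite eq_sym.
have nyz := covers_neq_le xy xz yz; have nzy := covers_neq_le xz xy zy.
have yw : covers y w.
  rewrite /w joinC; apply: (semimodular_join_covers semimod xz) => //.
  exact: ltW (covers_lt xy).
have zw : covers z w.
  by apply: (semimodular_join_covers semimod xy) => //; exact: ltW (covers_lt xz).
have nuw := covers_neq_le yu yw uw.
have nwu : ~~ (w <= u)%O by apply: covers_neq_le yw yu _; rewrite eq_sym.
set t := (u `|` w)%O.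
have ut : covers u t.
  rewrite /t joinC; apply: (semimodular_join_covers semimod yw) => //.
  exact: ltW (covers_lt yu).
have wt : covers w t.
  by apply: (semimodular_join_covers semimod yu) => //; exact: ltW (covers_lt yw).
rewrite ltNge le_eqVlt; apply/negP => /orP[/eqP E|slope_wu].
  by move: uw; rewrite (edge_slope_inj yw yu E) eqxx.
have xlty := covers_lt xy; have ylty := covers_lt yu; have wltt := covers_lt wt.
have ylew := covers_lt yw; have zltw := covers_lt zw.
(* At the height of [y] the path through [u] is to the left of the path through [z], at the height
   of [w] to its right. [path_side] forbids this exchange. *)
have [left_y left_w] : px y < path_at x z w (py y) /\ px w < path_at y u t (py w).
  split; apply: wedge_side => //.
  - by rewrite !inE negb_or yz lt_eqF.
  - exact: ltW (py_lt yw).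
  - by rewrite !inE negb_or eq_sym uw lt_eqF.
  - exact: ltW (py_lt wt).
have start : path_at y u t (py y) < path_at x z w (py y) by rewrite path_at_bot.
suff : path_at y u t (py w) < path_at x z w (py w).
  by rewrite path_at_top // => /(lt_trans left_w); rewrite ltxx.
have xw := lt_trans xlty ylew.
apply: (path_side yu ut xz zw _ _ _ _ _ _ _ _ start) => //.
- by rewrite !inE !negb_or yz (gt_eqF xlty) lt_eqF.
- rewrite !inE !negb_or uw (gt_eqF (lt_trans xlty ylty)) andbT /=.
  by apply: contraNneq nyz => <-; exact: ltW.
- by rewrite !inE !negb_or !gt_eqF // ?(lt_trans zltw) // (lt_trans xw).
- exact: ltW (py_lt yw).
- exact: ltW (py_lt wt).
- exact: ltW (py_lt xy).
Qed.

End UpwardPaths.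

Section DiagramSides.
Local Open Scope ring_scope.
Variables (R : realType) (D : planar_diagram R).
Implicit Types (x y z a b c e : D) (s : R).

Let X x : R := (pos x).1.
Let Y x : R := (pos x).2.

Let Y_lt x y : covers x y -> Y x < Y y.
Proof. by move=> /covers_lt/pos_upward. Qed.

Lemma edge_in_segment a b s : covers a b -> Y a <= s <= Y b ->
  segment (pos a) (pos b) (edge_at X Y a b s, s).
Proof.
move=> /Y_lt ab /andP[as_ sb]; have ab0 : Y b - Y a != 0 by rewrite subr_eq0 gt_eqF.
have ab_gt0 : 0 < Y b - Y a by rewrite subr_gt0.
exists ((s - Y a) / (Y b - Y a)).
  rewrite /= in_itv /= ler_pdivlMr // ler_pdivrMr // mul0r mul1r subr_ge0 as_ /=.
  by rewrite lerD2r.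
congr pair; rewrite /edge_at /edge_slope -/(X a) -/(X b) -/(Y a) -/(Y b); field; exact: ab0.
Qed.

Lemma diagram_edge_disjoint a b c e s : covers a b -> covers c e ->
  a \notin [:: c; e] -> b \notin [:: c; e] ->
  Y a <= s <= Y b -> Y c <= s <= Y e -> edge_at X Y a b s <> edge_at X Y c e s.
Proof.
move=> ab ce nace nbce sab sce E.
have pab := edge_in_segment ab sab; have := edge_in_segment ce sce; rewrite -E => pce.
have ne : (a, b) <> (c, e) by move=> [ac _]; rewrite ac !inE eqxx in nace.
have [m [mab mce] _] := pos_planar ab ce ne (conj pab pce).
have {}mce : m \in [:: c; e] by rewrite !inE; case: mce => ->; rewrite eqxx ?orbT.
by case: mab => mE; move: mce; rewrite mE ?(negPf nace) ?(negPf nbce).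
Qed.

(** With equal slopes, the lower of the two upper ends would lie on the other edge, which by
    planarity makes it [x] or the other end. *)
Lemma diagram_edge_slope_inj x y z : covers x y -> covers x z ->
  edge_slope X Y x y = edge_slope X Y x z -> y = z.
Proof.
wlog yz : y z / Y y <= Y z => [H xy xz E|xy xz E].
  have [yz|/ltW zy] := leP (Y y) (Y z); first exact: H.
  by apply/esym/H.
apply/eqP/negPn/negP => neq_yz.
have ne : (x, y) <> (x, z) by move=> [yzE]; rewrite yzE eqxx in neq_yz.
have yxy : Y x <= Y y <= Y y by rewrite lexx ltW ?Y_lt.
have yxz : Y x <= Y y <= Y z by rewrite yz ltW ?Y_lt.
have yE : edge_at X Y x z (Y y) = X y.
  by rewrite /edge_at -E -/(edge_at X Y x y (Y y)) edge_at_top.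
have := edge_in_segment xz yxz; rewrite yE => pxz.
have := edge_in_segment xy yxy; rewrite edge_at_top // => pxy.
have [m [_ mxz] mE] := pos_planar xy xz ne (conj pxy pxz).
have my : m = y.
  by apply: pos_inj; rewrite mE /X /Y; case: (pos y).
case: mxz => mz; last by rewrite -mz my eqxx in neq_yz.
by have := covers_lt xy; rewrite -my mz ltxx.
Qed.

Definition left_ofb x y z : bool := edge_slope X Y x y < edge_slope X Y x z.

Lemma left_ofbE x y z : left_of x y z = left_ofb x y z.
Proof. by []. Qed.

Lemma left_ofb_total x y z : covers x y -> covers x z -> y != z ->
  left_ofb x y z = ~~ left_ofb x z y.
Proof.
move=> xy xz yz; rewrite /left_ofb -leNgt le_eqVlt; case: eqP => //= E.
by rewrite (diagram_edge_slope_inj xy xz E) eqxx in yz.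
Qed.

Hypothesis semimod : semimodular D.

Lemma left_ofb_cell x y z u : covers x y -> covers x z -> left_ofb x y z ->
  covers y u -> u != (y `|` z)%O -> left_ofb y u (y `|` z)%O.
Proof.
exact: (cell_side Y_lt diagram_edge_disjoint diagram_edge_slope_inj semimod).
Qed.

(** Negating the abscissas preserves disjointness of edges and reverses slopes, so [cell_side]
    applies to the mirror image. *)
Lemma right_ofb_cell x y z u : covers x y -> covers x z -> left_ofb x z y ->
  covers y u -> u != (y `|` z)%O -> left_ofb y (y `|` z)%O u.
Proof.
pose X' a := - X a.
have slopeN a b : edge_slope X' Y a b = - edge_slope X Y a b.
  by rewrite /edge_slope /X' -mulNr opprB opprK addrC.
have atN a b s : edge_at X' Y a b s = - edge_at X Y a b s.
  by rewrite /edge_at slopeN mulNr -opprD.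
have disj a b c e s : covers a b -> covers c e -> a \notin [:: c; e] -> b \notin [:: c; e] ->
    Y a <= s <= Y b -> Y c <= s <= Y e -> edge_at X' Y a b s <> edge_at X' Y c e s.
  move=> ab ce nace nbce sab sce; rewrite !atN => /oppr_inj.
  exact: diagram_edge_disjoint.
have inj a b c : covers a b -> covers a c -> edge_slope X' Y a b = edge_slope X' Y a c -> b = c.
  by move=> ab ac; rewrite !slopeN => /oppr_inj; exact: diagram_edge_slope_inj.
move=> xy xz l yu uw; have := cell_side Y_lt disj inj semimod xy xz _ yu uw.
by rewrite !slopeN !ltrN2; apply.
Qed.

End DiagramSides.

(** * Classification *)

Section LatticeIsomorphisms.
Local Open Scope order_scope.

Lemma order_isomorphism_lattice d1 d2 (L1 : latticeType d1) (L2 : latticeType d2)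
    (f : L1 -> L2) :
  bijective f -> {mono f : x y / x <= y} -> lattice_isomorphism f.
Proof.
move=> fbij fle; have [g fK gK] := fbij; split=> // x y; apply/eqP.
  rewrite eq_le lexI !fle leIl leIr /= -[f x `&` f y]gK fle lexI -![g _ <= _]fle gK.
  by rewrite leIl leIr.
rewrite eq_le leUx !fle leUl leUr andbT -[f x `|` f y]gK fle leUx -![_ <= g _]fle gK.
by rewrite leUl leUr.
Qed.

Lemma lattice_isomorphism_le d1 d2 (L1 : latticeType d1) (L2 : latticeType d2)
    (f : L1 -> L2) :
  lattice_isomorphism f -> {mono f : x y / x <= y}.
Proof. by case=> fbij fI _ x y; rewrite !leEmeet -fI (bij_eq fbij). Qed.

Lemma order_isomorphism_covers d1 d2 (L1 : finPOrderType d1) (L2 : finPOrderType d2)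
    (f : L1 -> L2) :
  bijective f -> {mono f : x y / x <= y} -> {mono f : x y / covers x y}.
Proof.
move=> [g fK gK] fle x y; have flt := leW_mono fle; rewrite /covers flt; congr andb.
apply/forallP/forallP => nb z; first by have := nb (f z); rewrite !flt.
by rewrite -[z]gK !flt.
Qed.

Lemma order_isomorphism_bot d1 d2 (L1 : finTBLatticeType d1) (L2 : finTBLatticeType d2)
    (f : L1 -> L2) :
  bijective f -> {mono f : x y / x <= y} -> f \bot = \bot.
Proof. by move=> [g fK gK] fle; apply/eqP; rewrite -lex0 -[\bot in leRHS]gK fle le0x. Qed.

Lemma order_isomorphism_top d1 d2 (L1 : finTBLatticeType d1) (L2 : finTBLatticeType d2)
    (f : L1 -> L2) :
  bijective f -> {mono f : x y / x <= y} -> f \top = \top.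
Proof. by move=> [g fK gK] fle; apply/eqP; rewrite -le1x -[\top in leLHS]gK fle lex1. Qed.

Lemma covers_top d (L : finTBLatticeType d) (y : L) : covers \top y = false.
Proof. by apply/negP => /covers_lt/lt_geF; rewrite lex1. Qed.

Lemma rightmost_top d (L : finTBLatticeType d) (lr : L -> rel L) :
  rightmost lr \top = \top.
Proof. by rewrite /rightmost; case: pickP => // y; rewrite covers_top. Qed.

(** This makes the boundary chains invariants of similarity. *)
Lemma right_chain_isomorphism d1 d2 (L1 : finTBLatticeType d1) (L2 : finTBLatticeType d2)
    (lr1 : L1 -> rel L1) (lr2 : L2 -> rel L2) (f : L1 -> L2) k :
  bijective f -> {mono f : x y / x <= y} ->
  (forall x y z, covers x y -> covers x z -> lr2 (f x) (f y) (f z) = lr1 x y z) ->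
  (forall x y z : L1, covers x y -> covers x z -> y != z -> lr1 x y z = ~~ lr1 x z y) ->
  (forall x a b c : L1, covers x a -> covers x b -> covers x c ->
     [|| a == b, a == c | b == c]) ->
  f (right_chain lr1 k) = right_chain lr2 k.
Proof.
move=> fbij fle flr tot two; have fcov := order_isomorphism_covers fbij fle.
elim: k => [|k /= <-]; first exact: order_isomorphism_bot.
set x := right_chain lr1 k; have [->|xt] := eqVneq x \top.
  by rewrite rightmost_top (order_isomorphism_top fbij fle) rightmost_top.
have [xr xmax] := rightmostP tot two xt; have [g fK gK] := fbij.
have tot2 u v w : covers u v -> covers u w -> v != w -> lr2 u v w = ~~ lr2 u w v.
  rewrite -[u]gK -[v]gK -[w]gK !fcov (can_eq fK) => uv uw vw.
  by rewrite !flr // tot.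
apply/esym/(rightmost_unique tot2); rewrite ?fcov // => z.
rewrite -[z]gK fcov (can_eq fK) => xz zr.
by rewrite flr // xmax.
Qed.

End LatticeIsomorphisms.

Section QuadrantDiagram.
Variables (R : realType) (h : nat) (s : 'S_h).

Definition quadrant_diagram : planar_diagram R := rotated_diagram (@quadrant_coords_le h s) R.

Lemma left_ofb_quadrant (x y z : quadrant_lattice s) : covers x y -> covers x z ->
  @left_ofb R quadrant_diagram x y z = (coord1 (val y) < coord1 (val z)).
Proof.
move=> xy xz; apply/idP/idP; rewrite -left_ofbE => H.
  exact/(left_of_rotated (@quadrant_coords_le h s) R xy xz).
exact/(left_of_rotated (@quadrant_coords_le h s) R xy xz).
Qed.

(** A cover of [right_edge k] other than [right_edge k.+1] has first coordinate at most [k], hence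
    is further left. *)
Lemma right_chain_quadrant k : k <= h ->
  right_chain (@left_ofb R quadrant_diagram) k = right_edge s k.
Proof.
elim: k => [|k IHk] kh.
  by apply/eqP; rewrite -[_ == _]/(\bot%O == right_edge s 0) eq_sym -lex0 right_edge_le.
rewrite /= IHk ?(ltnW kh) //; apply: (rightmost_unique (@left_ofb_total R quadrant_diagram)).
  exact: right_edge_covers.
move=> z kz zk; have kk := right_edge_covers s kh.
rewrite (left_ofb_quadrant kz kk).
have : ~~ (right_edge s k.+1 <= z)%O by apply: covers_neq_le kk kz _; rewrite eq_sym.
rewrite right_edge_le // -ltnNge => /leq_trans; apply.
by rewrite -right_edge_le.
Qed.

(** Any other cover of [left_edge k] has a smaller second coordinate than [left_edge k.+1]; the two
    being incomparable, its first one is larger. *)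
Lemma left_chain_quadrant k : k <= h ->
  right_chain (fun x y z : quadrant_diagram => left_ofb x z y) k = left_edge s k.
Proof.
elim: k => [|k IHk] kh.
  by apply/eqP; rewrite -[_ == _]/(\bot%O == left_edge s 0) eq_sym -lex0 left_edge_le.
have tot (x y z : quadrant_diagram) : covers x y -> covers x z -> y != z ->
    left_ofb x z y = ~~ left_ofb x y z.
  by move=> xy xz yz; rewrite left_ofb_total // eq_sym.
rewrite /= IHk ?(ltnW kh) //; apply: (rightmost_unique tot).
  exact: left_edge_covers.
move=> z kz zk; have kk := left_edge_covers s kh.
rewrite (left_ofb_quadrant kk kz).
have : ~~ (left_edge s k.+1 <= z)%O by apply: covers_neq_le kk kz _; rewrite eq_sym.
rewrite left_edge_le // -ltnNge => zlt.
have kle : k.+1 <= coord2 s (val (left_edge s k.+1)) by rewrite -left_edge_le.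
have := coords_covers (@quadrant_coords_le h s) kk kz; rewrite eq_sym => /(_ zk).
by move: (leq_trans zlt kle) => lt2 [[]//|[_]]; rewrite ltnNge (ltnW lt2).
Qed.

End QuadrantDiagram.

Section Classification.
Variables (R : realType) (D : planar_diagram R).
Hypotheses (D_slim : slim D) (semimod : semimodular D).
Implicit Types x y z : D.

Let lr : D -> rel D := fun x y z => left_ofb x y z.
Let rl : D -> rel D := fun x y z => left_ofb x z y.
Let two x a b c := @slim_covers _ D x a b c D_slim.

Let lr_total x y z : covers x y -> covers x z -> y != z -> lr x y z = ~~ lr x z y.
Proof. exact: left_ofb_total. Qed.

Let rl_total x y z : covers x y -> covers x z -> y != z -> rl x y z = ~~ rl x z y.
Proof. by move=> xy xz yz; apply: left_ofb_total; rewrite // eq_sym. Qed.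

Lemma complete_right_chain (ord : D -> rel D) :
  (forall x y z, covers x y -> covers x z -> y != z -> ord x y z = ~~ ord x z y) ->
  exists h, complete_chain (right_chain ord) h.
Proof.
move=> tot; have [h ht nt] := right_chain_top tot two; exists h.
split=> // [i j|k kh]; first exact: right_chain_le.
by apply: (rightmost_lt tot two); exact: nt.
Qed.

Lemma right_chain_cover (ord : D -> rel D) :
  (forall x y z, covers x y -> covers x z -> y != z -> ord x y z = ~~ ord x z y) ->
  (forall x y z u, covers x y -> covers x z -> ord x y z ->
    covers y u -> u != (y `|` z)%O -> ord y u (y `|` z)%O) ->
  forall i x, (right_chain ord i <= x)%O -> ~~ (right_chain ord i.+1 <= x)%O ->
    covers x (x `|` right_chain ord i.+1)%O.
Proof.
move=> tot cell i x ix nix; rewrite (join_right_chain tot two semimod cell ix nix).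
apply: (rightmostP tot two _).1; apply: contraNneq nix => ->; exact: lex1.
Qed.

(** By slimness, a cover distinct from both extreme ones forces these to coincide, and would lie
    both to the left and to the right of them. *)
Lemma covers_rightmost x y : covers x y -> y = rightmost lr x \/ y = rightmost rl x.
Proof.
move=> xy; have xt : x != \top%O by apply: contraTneq xy => ->; rewrite covers_top.
have [xr rmax] := rightmostP lr_total two xt; have [xl lmax] := rightmostP rl_total two xt.
have [->|yr] := eqVneq y (rightmost lr x); first by left.
have [->|yl] := eqVneq y (rightmost rl x); first by right.
have := two xy xr xl; rewrite (negPf yr) (negPf yl) /= => /eqP E.
have := rmax y xy yr; have := lmax y xy yl; rewrite -E /rl -/(lr _ _ _).
by rewrite (lr_total xr xy) 1?eq_sym // => /negPf->.
Qed.

Lemma similar_quadrant_diagram :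
  exists h (s : 'S_h), similar_diagrams D (quadrant_diagram R s).
Proof.
have lr_cell := left_ofb_cell semimod.
have rl_cell x y z u : covers x y -> covers x z -> rl x y z -> covers y u ->
  u != (y `|` z)%O -> rl y u (y `|` z)%O by exact: (right_ofb_cell semimod).
have [h rP] := complete_right_chain lr_total.
have [h' lP] := complete_right_chain rl_total.
have r_cover := right_chain_cover lr_total lr_cell.
have l_cover := right_chain_cover rl_total rl_cell.
set r := right_chain lr in rP r_cover; set l := right_chain rl in lP l_cover.
have branch x y i j : covers x y -> (r i <= x)%O -> ~~ (r i.+1 <= x)%O ->
    (l j <= x)%O -> ~~ (l j.+1 <= x)%O ->
    y = (x `|` r i.+1)%O \/ y = (x `|` l j.+1)%O.
  move=> xy rx nrx lx nlx; rewrite (join_right_chain lr_total two semimod lr_cell rx nrx).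
  rewrite (join_right_chain rl_total two semimod rl_cell lx nlx).
  exact: covers_rightmost.
have [s [hh sP]] := corner_perm rP lP r_cover l_cover.
exists h, s; pose ri := chain_index r h; pose li := chain_index l h'.
pose f x : quadrant_diagram R s := Sub _ (quadrant_is_quadrant s (ri x) (li x)).
have rit : ri \top%O = h by exact: chain_index_top rP.
have lit : li \top%O = h by rewrite -hh; exact: chain_index_top lP.
(* The top goes to the empty quadrant, whose default coordinates are [h]; for other elements
   [coords_corner] provides what [coord_quadrant] requires. *)
have fcoord x : coord1 (val (f x)) = ri x /\ coord2 s (val (f x)) = li x.
  have [->|xt] := eqVneq x \top%O; last first.
    have [a [b [rx lx ab sba]]] := coords_corner rP lP r_cover l_cover hh sP xt.
    by rewrite /= /ri /li rx lx; exact: coord_quadrant.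
  rewrite /= rit lit; have := subxx (quadrant s h h).
  rewrite sub_quadrant // => /andP[h1 h2].
  by split; apply/eqP; rewrite eqn_leq ?coord1_le ?coord2_le.
have fle : {mono f : x y / (x <= y)%O}.
  move=> x y; rewrite quadrant_coords_le.
  have [-> ->] := fcoord x; have [-> ->] := fcoord y.
  by rewrite [RHS](chain_coords_le rP lP branch).
have fsurj A : exists x, f x = A.
  have [A0|A0] := eqVneq (val A) set0.
    exists \top%O; apply: val_inj; rewrite /= rit lit A0.
    by apply/setP => c; rewrite !inE leqNgt ltn_ord.
  have [a [b [aA bA a1 b2]]] := is_quadrant_corner (valP A) A0.
  have AE := quadrant_coords (valP A); rewrite a1 b2 in AE.
  have ab : a <= b by move: bA; rewrite -AE inE => /andP[].
  have sba : s b <= s a by move: aA; rewrite -AE inE => /andP[].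
  have [rE lE] := corner_coords rP lP r_cover l_cover hh sP ab sba.
  by exists (r a `|` l (s b))%O; apply: val_inj; rewrite /= /ri /li rE lE.
have fbij : bijective f.
  have [g gK] := fin_all_exists fsurj; exists g => // x.
  by apply: (inc_inj fle); rewrite gK.
exists f; split; first exact: order_isomorphism_lattice.
have fcov := order_isomorphism_covers fbij fle.
(* The right one [z] of two covers is [x]|[r (ri x).+1], so its first coordinate exceeds [ri x],
   whereas that of [y] does not. *)
have ri_lt x y z : covers x y -> covers x z -> left_ofb x y z -> ri y < ri z.
  move=> xy xz yz; have xt : x != \top%O by apply: contraTneq xy => ->; rewrite covers_top.
  have neq_yz : y != z by apply: contraTneq yz => ->; rewrite /left_ofb ltxx.
  have [rx nrx] := chain_index_spec rP xt; rewrite -/(ri x) in rx nrx.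
  have rE := join_right_chain lr_total two semimod lr_cell rx nrx.
  have zr : z = rightmost lr x.
    have [//|zl] := covers_rightmost xz.
    have [_ lmax] := rightmostP rl_total two xt.
    have := lmax y xy; rewrite -zl => /(_ neq_yz).
    by rewrite /rl left_ofb_total // 1?eq_sym // yz.
  have ix : (ri x).+1 <= h by exact: (chain_index_lt rP xt).
  have iz : (ri x).+1 <= ri z by rewrite -(chain_indexP rP) // zr -rE leUr.
  apply: leq_ltn_trans iz; rewrite leqNgt; apply/negP; rewrite -(chain_indexP rP) // => iy.
  have := covers_neq_le xz xy; rewrite eq_sym => /(_ neq_yz)/negP; apply.
  by rewrite zr -rE leUx iy (ltW (covers_lt xy)).
move=> x y z xy xz.
have fxy : covers (f x) (f y) by rewrite fcov.
have fxz : covers (f x) (f z) by rewrite fcov.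
rewrite !left_ofbE (left_ofb_quadrant R fxy fxz).
have [-> _] := fcoord y; have [-> _] := fcoord z.
split; first exact: ri_lt.
move=> yz; have neq_yz : y != z by apply: contraTneq yz => ->; rewrite ltnn.
rewrite left_ofb_total //; apply/negP => /(ri_lt _ _ _ xz xy).
by rewrite ltnNge (ltnW yz).
Qed.

End Classification.

(** * The permutation as an invariant of similarity *)

Section Uniqueness.
Variable R : realType.

Lemma quadrant_diagram_two_covers h (s : 'S_h) (x a b c : quadrant_diagram R s) :
  covers x a -> covers x b -> covers x c -> [|| a == b, a == c | b == c].
Proof. exact: slim_covers (@quadrant_slim h s). Qed.

Lemma similarity_edges h h' (s : 'S_h) (t : 'S_h')
    (f : quadrant_diagram R s -> quadrant_diagram R t) k :
  similarity_map f -> k <= h -> k <= h' ->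
  f (right_edge s k) = right_edge t k /\ f (left_edge s k) = left_edge t k.
Proof.
case=> fiso fl kh kh'; have [fbij _ _] := fiso.
have fle := lattice_isomorphism_le fiso.
have flr x y z : covers x y -> covers x z -> left_ofb (f x) (f y) (f z) = left_ofb x y z.
  by move=> xy xz; apply/idP/idP => /(fl _ _ _ xy xz).
split.
  rewrite -(right_chain_quadrant R s kh) -(right_chain_quadrant R t kh').
  apply: right_chain_isomorphism => //; first exact: left_ofb_total.
  exact: quadrant_diagram_two_covers.
rewrite -(left_chain_quadrant R s kh) -(left_chain_quadrant R t kh').
apply: right_chain_isomorphism => //.
- by move=> x y z xy xz; exact: flr.
- by move=> x y z xy xz yz; apply: left_ofb_total; rewrite // eq_sym.
- exact: quadrant_diagram_two_covers.
Qed.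

Lemma right_edge_top h (s : 'S_h) : right_edge s h = \top%O.
Proof. by apply/val_inj/setP => c; rewrite !inE leqNgt ltn_ord. Qed.

(** If [h < h'], the top [right_edge s h] would be sent to [right_edge t h], which still has a
    cover. *)
Lemma similar_quadrant_size h h' (s : 'S_h) (t : 'S_h') :
  similar_diagrams (quadrant_diagram R s) (quadrant_diagram R t) -> h' <= h.
Proof.
case=> f fs; rewrite leqNgt; apply/negP => hh'.
have [+ _] := similarity_edges fs (leqnn h) (ltnW hh'); have [fiso _] := fs.
have [fbij _ _] := fiso; rewrite right_edge_top.
rewrite (order_isomorphism_top fbij (lattice_isomorphism_le fiso)) => E.
by have := right_edge_covers t hh'; rewrite -E covers_top.
Qed.

(** Coordinates are determined by the edges below an element, so a similarity preserves them. The
    image of the quadrant at (a, s a) is nonempty with these coordinates, hence contains the point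
    [a] of [t]. Equality follows by symmetry. *)
Lemma similar_quadrant_perm_le h (s t : 'S_h) (a : 'I_h) :
  similar_diagrams (quadrant_diagram R s) (quadrant_diagram R t) -> s a <= t a.
Proof.
case=> f fs; have [fiso _] := fs; have fle := lattice_isomorphism_le fiso.
have coordE x : coord1 (val (f x)) = coord1 (val x) /\ coord2 t (val (f x)) = coord2 s (val x).
  have leE k : k <= h -> (k <= coord1 (val (f x))) = (k <= coord1 (val x)) /\
      (k <= coord2 t (val (f x))) = (k <= coord2 s (val x)).
    move=> kh; have [rE lE] := similarity_edges fs kh kh.
    rewrite -!right_edge_le -?left_edge_le // -rE -lE.
    by split; exact: fle.
  have eq_of_le u v : u <= h -> v <= h -> (forall k, k <= h -> (k <= u) = (k <= v)) -> u = v.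
    by move=> uh vh H; apply/eqP; rewrite eqn_leq -(H u uh) (H v vh) !leqnn.
  split; apply: eq_of_le => [||k kh]; rewrite ?coord1_le ?coord2_le //.
    by have [] := leE k kh.
  by have [] := leE k kh.
pose x : quadrant_diagram R s := Sub _ (quadrant_is_quadrant s a (s a)).
have [x1 x2] := coord_quadrant (leqnn a) (leqnn (s a)).
have [f1 f2] := coordE x; rewrite /= x1 in f1; rewrite /= x2 in f2.
have fx0 : val (f x) != set0.
  apply: contraTneq (ltn_ord a) => E; rewrite -leqNgt -f1.
  have : val (f x) \subset quadrant t h h by rewrite E sub0set.
  by rewrite sub_quadrant // => /andP[].
have [a' [b' [aA _ a1 _]]] := is_quadrant_corner (valP (f x)) fx0.
have aa : a' = a by apply: val_inj; rewrite /= -a1.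
by move: aA; rewrite aa -(quadrant_coords (valP (f x))) inE f2 => /andP[].
Qed.

Lemma similar_quadrant_diagram_inj h h' (s : 'S_h) (t : 'S_h') :
  similar_diagrams (quadrant_diagram R s) (quadrant_diagram R t) ->
  Tagged (fun h => 'S_h) s = Tagged (fun h => 'S_h) t.
Proof.
move=> st; have ts := similar_diagrams_sym st.
have hh : h = h'.
  by apply/eqP; rewrite eqn_leq (similar_quadrant_size st) (similar_quadrant_size ts).
subst h'; congr Tagged; apply/permP => a; apply/val_inj/eqP.
by rewrite eqn_leq (similar_quadrant_perm_le a st) (similar_quadrant_perm_le a ts).
Qed.

End Uniqueness.

Theorem proposition3p3 (R : realType) (n : nat) :
  (0 < n)%N ->
  number_up_to (@similar_diagrams R) (@slim_semimodular_diagram R n)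
    (\sum_(h < n) num_perm_inversions h (n - h - 1))%N.
Proof.
move=> _.
(* The lattice of [s] has [(h + inversions s).+1] elements, so size [n] means [h < n] and
   [n - h - 1] inversions. *)
pose I := {h : 'I_n & {s : 'S_h | inversions s == n - h - 1}}.
have cardI : #|{: I}| = \sum_(h < n) num_perm_inversions h (n - h - 1).
  rewrite card_tagged sumnE big_map big_enum; apply: eq_bigr => h _.
  by rewrite card_sig /num_perm_inversions cardsE.
rewrite -cardI; exists (fun i => quadrant_diagram R (val (tagged (enum_val i)))); split.
- move=> i; case: (enum_val i) => h [s /= /eqP inv_s].
  split; [exact: quadrant_slim|exact: quadrant_semimodular|].
  rewrite [LHS](card_quadrant_lattice s) inv_s.
  by have := ltn_ord h; lia.
- move=> i j /similar_quadrant_diagram_inj; move=> E; apply: enum_val_inj; move: E.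
  case: (enum_val i) (enum_val j) => [h [s ps]] [h' [t pt]] /= E.
  have hh : h = h' by apply: val_inj; exact: (congr1 tag E).
  subst h'; congr Tagged; apply: val_inj => /=.
  exact: eq_from_Tagged E.
- move=> D [D_slim semimod cardD].
  have [h [s Ds]] := similar_quadrant_diagram D_slim semimod.
  have cardE : n = (h + inversions s).+1.
    case: Ds => f [[fbij _ _] _].
    by rewrite -cardD (bij_eq_card fbij); exact: card_quadrant_lattice.
  have hn : h < n by rewrite cardE ltnS leq_addr.
  have inv_s : inversions s == n - Ordinal hn - 1 by rewrite /=; lia.
  pose u : I := Tagged (fun h : 'I_n => {s : 'S_h | inversions s == n - h - 1})
    (exist _ s inv_s : {s : 'S_(Ordinal hn) | inversions s == n - Ordinal hn - 1}).
  by exists (enum_rank u); rewrite enum_rankK.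
Qed.
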